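(* Let $V$ be a two sided quaternionic Banach space, let $T\in\mathcal B(V)$ and let $\sigma_S(T)=\sigma_{1S}\cup\sigma_{2S}$ with $\mathrm{dist}(\sigma_{1S},\sigma_{2S})>0$. Let $U_1,U_2\subset\mathbb H$ be two open sets (axially symmetric and such that $\partial(U_j\cap\mathbb C_I)$ is a finite union of continuously differentiable Jordan curves for every $I\in\mathbb S$) with $\sigma_{1S}\subset U_1$, $\sigma_{2S}\subset U_2$ and $\overline U_1\cap\overline U_2=\emptyset$. Set $$P_j:=\frac1{2\pi}\int_{\partial(U_j\cap\mathbb C_I)}S_L^{-1}(s,T)\,ds_I,\qquad T_j:=\frac1{2\pi}\int_{\partial(U_j\cap\mathbb C_I)}S_L^{-1}(s,T)\,ds_I\,s,\qquad j=1,2,$$ where $I\in\mathbb S$. Then: (1) $P_j$ are projectors (that is, $P_j^2=P_j$) and $TP_j=P_jT$ for $j=1,2$. (2) For $\lambda\in\rho_S(T)$ and $j=1,2$, $$P_jS_L^{-1}(\lambda,T)\lambda-T_jS_L^{-1}(\lambda,T)=P_j,\qquad \lambda S_R^{-1}(\lambda,T)P_j-S_R^{-1}(\lambda,T)T_j=P_j .$$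
   Context: $\mathbb H$ is the algebra of quaternions, $\mathbb S$ the 2-sphere of purely imaginary unit quaternions, and $\mathbb C_I=\mathbb R+I\mathbb R$ for $I\in\mathbb S$. A set $U\subseteq\mathbb H$ is axially symmetric if whenever it contains $x+Iy$ ($x,y\in\mathbb R$, $I\in\mathbb S$) it contains $x+Jy$ for all $J\in\mathbb S$. $\mathcal B(V)$ is the two sided $\mathbb H$-vector space of bounded right linear operators on $V$, where $(sT)(v)=s\,T(v)$ and $(Ts)(v)=T(sv)$ for $s\in\mathbb H$; $\mathcal I$ is the identity operator. The $S$-spectrum of $T$ is $\sigma_S(T)=\{s\in\mathbb H: T^2-2\mathrm{Re}(s)T+|s|^2\mathcal I\text{ is not invertible}\}$, and $\rho_S(T)=\mathbb H\setminus\sigma_S(T)$. For $s\in\rho_S(T)$ the left and right $S$-resolvent operators are $$S_L^{-1}(s,T)=-(T^2-2\mathrm{Re}(s)T+|s|^2\mathcal I)^{-1}(T-\overline s\,\mathcal I),\quad S_R^{-1}(s,T)=-(T-\overline s\,\mathcal I)(T^2-2\mathrm{Re}(s)T+|s|^2\mathcal I)^{-1}.$$ In the integrals, $ds_I=-ds\,I$, where $s$ runs over the positively oriented boundary of $U_j\cap\mathbb C_I$ in the complex plane $\mathbb C_I$.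
   Formalization: ''Positively oriented boundary'' is taken to mean winding number 1 about points of U_j∩C_I and 0 off its closure, which forces U_j∩C_I to be bounded; for unbounded U_j the claim fails (T=diag(0,3), U_1={|s|<1}, U_2={|s|>2} give P_2=-diag(1,0), not a projector). *)

(* Defs.v *)
From Stdlib Require Import Reals Lra List.
From Stdlib Require Import Classical ClassicalEpsilon.
From Stdlib Require Import FunctionalExtensionality PropExtensionality ProofIrrelevance.
From Coquelicot Require Import Coquelicot.

Set Implicit Arguments.
Unset Strict Implicit.
Open Scope R_scope.

Section Completeness.
Variable T : UniformSpace.

Definition filter_limit (F : (T -> Prop) -> Prop) : T :=
  epsilon (inhabits (UniformSpace.point_of T (UniformSpace.class T)))
    (fun l => forall eps : posreal, F (ball l eps)).

Hypothesis cauchy_limit : forall F : (T -> Prop) -> Prop,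
  ProperFilter F -> cauchy F -> exists l, forall eps : posreal, F (ball l eps).

Lemma filter_limit_cauchy (F : (T -> Prop) -> Prop) :
  ProperFilter F -> cauchy F ->
  forall eps : posreal, F (ball (filter_limit F) eps).
Proof.
intros HF cF.
exact (epsilon_spec (inhabits (UniformSpace.point_of T (UniformSpace.class T)))
         (fun l => forall eps : posreal, F (ball l eps)) (cauchy_limit HF cF)).
Qed.

Lemma filter_limit_ext (F1 F2 : (T -> Prop) -> Prop) :
  filter_le F1 F2 -> filter_le F2 F1 ->
  close (filter_limit F1) (filter_limit F2).
Proof.
intros h12 h21.
replace F2 with F1; [apply close_refl|].
apply functional_extensionality; intro P.
apply propositional_extensionality; split; [apply h21|apply h12].
Qed.

Definition complete_mixin : CompleteSpace.mixin_of T :=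
  @CompleteSpace.Mixin T filter_limit filter_limit_cauchy filter_limit_ext.

End Completeness.

Lemma minus_plus_plus (G : AbelianGroup) (u v u' v' : G) :
  minus (plus u v) (plus u' v') = plus (minus u u') (minus v v').
Proof.
unfold minus; rewrite opp_plus, <- !plus_assoc; f_equal.
rewrite !plus_assoc; f_equal; apply plus_comm.
Qed.

Section Distances.
Variable V : NormedModule R_AbsRing.
Implicit Types u v w : V.

Lemma eq_of_dist_le u v :
  (forall e, 0 < e -> norm (minus u v) <= e) -> u = v.
Proof.
intro h.
assert (z : norm (minus u v) = 0).
{ apply Rle_antisym; [|apply norm_ge_0]; apply le_epsilon; intros e he.
  rewrite Rplus_0_l; auto. }
apply norm_eq_zero in z.
apply (plus_reg_r (opp v)).
etransitivity; [exact z|symmetry; exact (plus_opp_r v)].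
Qed.

Lemma dist_trans u v w : norm (minus u w) <= norm (minus v u) + norm (minus v w).
Proof.
rewrite (minus_trans v u w), <- (norm_opp (minus v u)), opp_minus.
apply norm_triangle.
Qed.

Lemma dist_plus u v u' v' :
  norm (minus (plus u v) (plus u' v')) <=
  norm (minus u u') + norm (minus v v').
Proof.
pose proof (minus_plus_plus u v u' v') as e.
eapply Rle_trans; [right; exact (f_equal norm e)|].
exact (norm_triangle (minus u u') (minus v v')).
Qed.

Lemma norm_le_dist u v : norm u <= norm (minus v u) + norm v.
Proof.
pose proof (dist_trans u v zero) as h.
assert (e : forall x : V, minus x zero = x) by (intro x; exact (minus_zero_r x)).
now rewrite !e in h.
Qed.

End Distances.

(* [(a, b, c, d)] stands for [a + b i + c j + d k].  Addition, real scaling,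
   topology and norm come from the product structure of Coquelicot, whose norm
   is the Euclidean one. *)

Definition quat : Type := (R * R * R * R)%type.

Definition quat_prod : NormedModule R_AbsRing :=
  prod_NormedModule R_AbsRing
    (prod_NormedModule R_AbsRing
       (prod_NormedModule R_AbsRing R_NormedModule R_NormedModule)
       R_NormedModule)
    R_NormedModule.

Canonical quat_UniformSpace : UniformSpace :=
  UniformSpace.Pack quat (UniformSpace.class quat_prod) quat.
Canonical quat_AbelianMonoid : AbelianMonoid :=
  AbelianMonoid.Pack quat (AbelianMonoid.class quat_prod) quat.
Canonical quat_AbelianGroup : AbelianGroup :=
  AbelianGroup.Pack quat (AbelianGroup.class quat_prod) quat.
Canonical quat_ModuleSpace : ModuleSpace R_Ring :=
  ModuleSpace.Pack R_Ring quat (ModuleSpace.class R_Ring quat_prod) quat.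
Canonical quat_NormedModuleAux : NormedModuleAux R_AbsRing :=
  NormedModuleAux.Pack R_AbsRing quat
    (NormedModuleAux.class R_AbsRing quat_prod) quat.
Canonical quat_NormedModule : NormedModule R_AbsRing :=
  NormedModule.Pack R_AbsRing quat (NormedModule.class R_AbsRing quat_prod) quat.

Definition qre (q : quat) : R := let '(a, b, c, d) := q in a.

Definition qconj (q : quat) : quat :=
  let '(a, b, c, d) := q in (a, - b, - c, - d).

Definition qreal (r : R) : quat := (r, 0, 0, 0).

Definition qmult (p q : quat) : quat :=
  let '(a1, b1, c1, d1) := p in
  let '(a2, b2, c2, d2) := q in
  (a1 * a2 - b1 * b2 - c1 * c2 - d1 * d2,
   a1 * b2 + b1 * a2 + c1 * d2 - d1 * c2,
   a1 * c2 - b1 * d2 + c1 * a2 + d1 * b2,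
   a1 * d2 + b1 * c2 - c1 * b2 + d1 * a2).

Lemma quat_eq (a b c d a' b' c' d' : R) :
  a = a' -> b = b' -> c = c' -> d = d' -> (a, b, c, d) = (a', b', c', d') :> quat.
Proof. now intros -> -> -> ->. Qed.

Lemma qmultA (x y z : quat) : qmult x (qmult y z) = qmult (qmult x y) z.
Proof.
destruct x as [[[? ?] ?] ?], y as [[[? ?] ?] ?], z as [[[? ?] ?] ?].
apply quat_eq; ring.
Qed.

Lemma qmult1r (x : quat) : qmult x (qreal 1) = x.
Proof. destruct x as [[[? ?] ?] ?]; apply quat_eq; ring. Qed.

Lemma qmult1l (x : quat) : qmult (qreal 1) x = x.
Proof. destruct x as [[[? ?] ?] ?]; apply quat_eq; ring. Qed.

Lemma qmultDl (x y z : quat) :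
  qmult (plus x y) z = plus (qmult x z) (qmult y z).
Proof.
destruct x as [[[? ?] ?] ?], y as [[[? ?] ?] ?], z as [[[? ?] ?] ?].
apply quat_eq; cbn; ring.
Qed.

Lemma qmultDr (x y z : quat) :
  qmult x (plus y z) = plus (qmult x y) (qmult x z).
Proof.
destruct x as [[[? ?] ?] ?], y as [[[? ?] ?] ?], z as [[[? ?] ?] ?].
apply quat_eq; cbn; ring.
Qed.

Definition quat_Ring_mixin : Ring.mixin_of quat_AbelianGroup :=
  @Ring.Mixin quat_AbelianGroup qmult (qreal 1)
    qmultA qmult1r qmult1l qmultDl qmultDr.

Canonical quat_Ring : Ring :=
  Ring.Pack quat (Ring.Class _ _ quat_Ring_mixin) quat.

Lemma quat_normE (a b c d : R) :
  norm ((a, b, c, d) : quat) = sqrt (a ^ 2 + b ^ 2 + c ^ 2 + d ^ 2).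
Proof.
change (norm ((a, b, c, d) : quat)) with
  (sqrt (sqrt (sqrt (Rabs a ^ 2 + Rabs b ^ 2) ^ 2 + Rabs c ^ 2) ^ 2
         + Rabs d ^ 2)).
assert (sq : forall x, 0 <= x -> sqrt x ^ 2 = x).
{ intros x hx; now apply pow2_sqrt. }
rewrite !pow2_abs.
rewrite !sq; auto.
- pose proof (pow2_ge_0 a); pose proof (pow2_ge_0 b); lra.
- rewrite !sq; pose proof (pow2_ge_0 a); pose proof (pow2_ge_0 b);
    pose proof (pow2_ge_0 c); lra.
Qed.

Lemma quat_cauchy_limit (F : (quat -> Prop) -> Prop) :
  ProperFilter F -> cauchy F -> exists l, forall eps : posreal, F (ball l eps).
Proof.
intros HF cF.
pose (pr := fun (f : quat -> R) => filtermap f F).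
assert (H : forall f : quat -> R,
   (forall x y eps, ball x eps y -> ball (f x) eps (f y)) ->
   forall eps : posreal, F (fun y => ball (lim (pr f)) eps (f y))).
{ intros f hf eps.
  apply (complete_cauchy (pr f)).
  - now apply filtermap_proper_filter.
  - intros e; destruct (cF e) as [x hx]; exists (f x).
    unfold pr, filtermap; revert hx; apply filter_imp.
    intros y; apply hf. }
exists (lim (pr (fun q => fst (fst (fst q)))),
        lim (pr (fun q => snd (fst (fst q)))),
        lim (pr (fun q => snd (fst q))), lim (pr (fun q => snd q))).
intros eps.
pose proof (H (fun q => fst (fst (fst q)))
  ltac:(now intros x y e [[[h1 h2] h3] h4]) eps) as H1.
pose proof (H (fun q => snd (fst (fst q)))
  ltac:(now intros x y e [[[h1 h2] h3] h4]) eps) as H2.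
pose proof (H (fun q => snd (fst q))
  ltac:(now intros x y e [[[h1 h2] h3] h4]) eps) as H3.
pose proof (H (fun q => snd q)
  ltac:(now intros x y e [[[h1 h2] h3] h4]) eps) as H4.
generalize (filter_and _ _ (filter_and _ _ H1 H2) (filter_and _ _ H3 H4)).
apply filter_imp; intros y [[h1 h2] [h3 h4]].
now repeat split.
Qed.

Canonical quat_CompleteSpace : CompleteSpace :=
  CompleteSpace.Pack quat
    (CompleteSpace.Class _ _ (complete_mixin quat_cauchy_limit)) quat.
Canonical quat_CompleteNormedModule : CompleteNormedModule R_AbsRing :=
  CompleteNormedModule.Pack R_AbsRing quat
    (CompleteNormedModule.Class R_AbsRing _
       (NormedModule.class R_AbsRing quat_NormedModule)
       (complete_mixin quat_cauchy_limit)) quat.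

Definition qinv (q : quat) : quat := scal (/ norm q ^ 2) (qconj q).

Definition imag_unit (I : quat) : Prop := qre I = 0 /\ norm I = 1.

Definition slice_point (I : quat) (x y : R) : quat := plus (qreal x) (scal y I).

Definition slice (I s : quat) : Prop := exists x y, s = slice_point I x y.

Definition axially_symmetric (U : quat -> Prop) : Prop :=
  forall (x y : R) (I J : quat), imag_unit I -> imag_unit J ->
    U (slice_point I x y) -> U (slice_point J x y).

Definition closure (A : quat -> Prop) (s : quat) : Prop :=
  forall N : quat -> Prop, locally s N -> exists t, N t /\ A t.

(* Infimum of an empty set of distances is [p_infty]. *)
Definition set_dist (A B : quat -> Prop) : Rbar :=
  Glb_Rbar (fun d => exists s t, A s /\ B t /\ d = norm (minus s t)).

(* Boundary of [U] intersected with the slice, relative to the slice. *)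
Definition slice_boundary (I : quat) (U : quat -> Prop) (s : quat) : Prop :=
  slice I s /\
  closure (fun t => slice I t /\ U t) s /\
  closure (fun t => slice I t /\ ~ U t) s.

(* A [C^1] function on [[0,1]] extends to a [C^1] function on [R], so two-sided
   derivatives at the end points are no restriction. *)
Record jordan_curve (I : quat) : Type := JordanCurve {
  path : R -> quat;
  velocity : R -> quat;
  path_slice : forall t, 0 <= t <= 1 -> slice I (path t);
  path_derive : forall t, 0 <= t <= 1 -> is_derive path t (velocity t);
  velocity_continuous : forall t, 0 <= t <= 1 -> continuous velocity t;
  path_closed : path 0 = path 1;
  path_simple : forall t u, 0 <= t < 1 -> 0 <= u < 1 -> path t = path u -> t = u
}.

Definition on_curves (I : quat) (G : list (jordan_curve I)) (s : quat) : Prop :=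
  exists g, In g G /\ exists t, 0 <= t <= 1 /\ path g t = s.

Definition jordan_boundary (I : quat) (U : quat -> Prop) : Prop :=
  exists G : list (jordan_curve I),
    forall s, slice_boundary I U s <-> on_curves G s.

(* [contour_integral G w] is the sum over the curves of [G] of the integrals of
   [w s ds_I], where [ds_I = - ds I]. *)
Definition contour_integral (E : CompleteNormedModule R_AbsRing) (I : quat)
    (G : list (jordan_curve I)) (w : quat -> quat -> E) : E :=
  fold_right plus zero
    (map (fun g => RInt (fun t => w (path g t)
                                    (mult (opp (velocity g t)) I)) 0 1) G).

(* Inside a slice [ds_I = ds / I], so this is the usual winding number
   [1 / (2 PI I)] times the integral of [ds / (s - a)]. *)
Definition winding (I : quat) (G : list (jordan_curve I)) (a : quat) : quat :=
  scal (/ (2 * PI))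
    (contour_integral G (fun s dsI => mult dsI (qinv (minus s a)))).

(* [G] is the positively oriented boundary of [U] in the slice, in Ahlfors'
   sense that the cycle [G] bounds [U]: winding number one around the points of
   [U], zero around the points off the closure.  This forces [U] to be bounded
   in the slice. *)
Definition positive_boundary (I : quat) (U : quat -> Prop)
    (G : list (jordan_curve I)) : Prop :=
  (forall s, slice_boundary I U s <-> on_curves G s) /\
  (forall a, slice I a -> U a -> winding G a = one) /\
  (forall a, slice I a -> ~ closure (fun t => slice I t /\ U t) a ->
     winding G a = zero).

Record TwoSidedBanach : Type := {
  tsb_space :> CompleteNormedModule R_AbsRing;
  lmul : quat -> tsb_space -> tsb_space;
  rmul : tsb_space -> quat -> tsb_space;
  lmulDr : forall s u v, lmul s (plus u v) = plus (lmul s u) (lmul s v);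
  lmulDl : forall s t v, lmul (plus s t) v = plus (lmul s v) (lmul t v);
  lmulA : forall s t v, lmul s (lmul t v) = lmul (mult s t) v;
  rmulDl : forall u v s, rmul (plus u v) s = plus (rmul u s) (rmul v s);
  rmulDr : forall v s t, rmul v (plus s t) = plus (rmul v s) (rmul v t);
  rmulA : forall v s t, rmul (rmul v s) t = rmul v (mult s t);
  lrmulA : forall s v t, rmul (lmul s v) t = lmul s (rmul v t);
  lmul_real : forall r v, lmul (qreal r) v = scal r v;
  rmul_real : forall v r, rmul v (qreal r) = scal r v;
  norm_lmul : forall s v, norm (lmul s v) = norm s * norm v;
  norm_rmul : forall v s, norm (rmul v s) = norm v * norm s
}.

(* The addition on [BOp V] is pointwise, the product [mult] is composition, and
   the norm is the operator norm. *)
Record BOp (V : TwoSidedBanach) : Type := {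
  op :> V -> V;
  op_plus : forall u v, op (plus u v) = plus (op u) (op v);
  op_rmul : forall v s, op (rmul v s) = rmul (op v) s;
  op_bounded : exists M, forall v, norm (op v) <= M * norm v
}.

Section Operators.
Variable V : TwoSidedBanach.
Implicit Types (T S : BOp V) (s : quat) (v : V).

Lemma vnorm_triangle (u v : V) : norm (plus u v) <= norm u + norm v.
Proof. exact (norm_triangle u v). Qed.

Lemma vnorm_scal (r : R) v : norm (scal r v) = Rabs r * norm v.
Proof.
assert (le : forall (t : R) (u : V), norm (scal t u) <= Rabs t * norm u)
  by (intros t u; exact (norm_scal (K := R_AbsRing) t u)).
destruct (Req_dec r 0) as [->|h].
{ rewrite Rabs_R0, Rmult_0_l; apply Rle_antisym; [|apply norm_ge_0].
  eapply Rle_trans; [apply le|]; rewrite Rabs_R0; lra. }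
apply Rle_antisym; [apply le|].
pose proof (Rabs_pos_lt r h).
apply Rmult_le_reg_l with (/ Rabs r); [now apply Rinv_0_lt_compat|].
rewrite <- Rmult_assoc, Rinv_l, Rmult_1_l by lra.
rewrite <- Rabs_inv.
eapply Rle_trans; [|apply le].
right; f_equal; symmetry.
etransitivity; [exact (scal_assoc (K := R_Ring) (/ r) r v)|].
change (scal (/ r * r) v = v); rewrite Rinv_l by exact h.
exact (scal_one (K := R_Ring) v).
Qed.

Lemma vnorm_zero : norm (zero : V) = 0.
Proof. exact (norm_zero (V := V)). Qed.

Lemma vnorm_opp v : norm (opp v) = norm v.
Proof. exact (norm_opp v). Qed.

Lemma BOp_eq T S : (forall v, T v = S v) -> T = S.
Proof.
destruct T as [f a b c], S as [g a' b' c']; simpl; intro h.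
assert (e : f = g) by now apply functional_extensionality.
subst g; f_equal; apply proof_irrelevance.
Qed.

Lemma op_scal T (r : R) v : T (scal r v) = scal r (T v).
Proof. now rewrite <- !rmul_real, op_rmul. Qed.

Lemma scal0 v : scal 0 v = zero.
Proof. exact (scal_zero_l (K := R_Ring) v). Qed.

Lemma scalN1 v : scal (-1) v = opp v.
Proof. exact (scal_opp_one (K := R_Ring) v). Qed.

Lemma op_zero T : T zero = zero.
Proof.
replace (T zero) with (T (scal 0 zero)) by (f_equal; apply scal0).
rewrite op_scal; apply scal0.
Qed.

Lemma op_opp T v : T (opp v) = opp (T v).
Proof. now rewrite <- !scalN1, op_scal. Qed.

Lemma op_bounded_pos T :
  exists M, 0 <= M /\ forall v, norm (T v) <= M * norm v.
Proof.
destruct (op_bounded T) as [M hM]; exists (Rmax M 0); split; [apply Rmax_r|].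
intro v; eapply Rle_trans; [apply hM|].
apply Rmult_le_compat_r; [apply norm_ge_0|apply Rmax_l].
Qed.

Lemma rmul_scal (r : R) v s : rmul (scal r v) s = scal r (rmul v s).
Proof. now rewrite <- !lmul_real, lrmulA. Qed.

Program Definition Bplus T S : BOp V := {| op := fun v => plus (T v) (S v) |}.
Next Obligation.
rewrite !op_plus, !plus_assoc; f_equal.
now rewrite <- !plus_assoc, (plus_comm (T v)).
Qed.
Next Obligation. now rewrite !op_rmul, rmulDl. Qed.
Next Obligation.
destruct (op_bounded T) as [M hM], (op_bounded S) as [N hN].
exists (M + N); intro v; eapply Rle_trans; [apply vnorm_triangle|].
specialize (hM v); specialize (hN v); lra.
Qed.

Program Definition Bscal (r : R) T : BOp V := {| op := fun v => scal r (T v) |}.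
Next Obligation. rewrite op_plus; exact (scal_distr_l (K := R_Ring) r _ _). Qed.
Next Obligation. now rewrite op_rmul, rmul_scal. Qed.
Next Obligation.
destruct (op_bounded T) as [M hM].
exists (Rabs r * M); intro v.
rewrite vnorm_scal, Rmult_assoc; apply Rmult_le_compat_l; [apply Rabs_pos|].
apply hM.
Qed.

Definition Bopp T : BOp V := Bscal (-1) T.

Program Definition Bzero : BOp V := {| op := fun _ => zero |}.
Next Obligation. now rewrite plus_zero_l. Qed.
Next Obligation.
symmetry; replace (rmul zero s) with (rmul (scal 0 zero) s : V)
  by (f_equal; apply scal0).
rewrite rmul_scal; apply scal0.
Qed.
Next Obligation.
exists 0; intro v.
change (norm (zero : V) <= 0 * norm v); rewrite vnorm_zero; lra.
Qed.

Program Definition Bone : BOp V := {| op := fun v => v |}.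
Next Obligation. exists 1; intro v; lra. Qed.

Program Definition Bcomp T S : BOp V := {| op := fun v => T (S v) |}.
Next Obligation. now rewrite !op_plus. Qed.
Next Obligation. now rewrite !op_rmul. Qed.
Next Obligation.
destruct (op_bounded_pos T) as [M [M0 hM]], (op_bounded S) as [N hN].
exists (M * N); intro v; eapply Rle_trans; [apply hM|].
rewrite Rmult_assoc; apply Rmult_le_compat_l; auto.
Qed.

Program Definition Blmul s T : BOp V := {| op := fun v => lmul s (T v) |}.
Next Obligation. now rewrite op_plus, lmulDr. Qed.
Next Obligation. now rewrite op_rmul, lrmulA. Qed.
Next Obligation.
destruct (op_bounded T) as [M hM].
exists (norm s * M); intro v.
rewrite norm_lmul, Rmult_assoc; apply Rmult_le_compat_l; [apply norm_ge_0|].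
apply hM.
Qed.

Program Definition Brmul T s : BOp V := {| op := fun v => T (lmul s v) |}.
Next Obligation. now rewrite lmulDr, op_plus. Qed.
Next Obligation. now rewrite <- lrmulA, op_rmul. Qed.
Next Obligation.
destruct (op_bounded T) as [M hM].
exists (M * norm s); intro v.
eapply Rle_trans; [apply hM|].
rewrite norm_lmul; lra.
Qed.

Definition Bnorm T : R :=
  real (Lub_Rbar (fun r => exists v, norm v <= 1 /\ r = norm (T v))).

Lemma Bnorm_finite T :
  is_lub_Rbar (fun r => exists v, norm v <= 1 /\ r = norm (T v)) (Bnorm T).
Proof.
unfold Bnorm.
set (E := fun r => _).
pose proof (Lub_Rbar_correct E) as h.
destruct (op_bounded_pos T) as [M [M0 hM]].
assert (u : Rbar_le (Lub_Rbar E) M).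
{ apply h; intros x [v [hv ->]]; simpl.
  eapply Rle_trans; [apply hM|].
  rewrite <- (Rmult_1_r M) at 2; now apply Rmult_le_compat_l. }
assert (l : Rbar_le 0 (Lub_Rbar E)).
{ apply h; exists zero; rewrite op_zero, vnorm_zero; split; [lra|reflexivity]. }
destruct (Lub_Rbar E) as [x| |]; simpl in *; tauto.
Qed.

Lemma Bnorm_ge0 T : 0 <= Bnorm T.
Proof.
apply (proj1 (Bnorm_finite T)); exists zero.
rewrite op_zero, vnorm_zero; split; [lra|reflexivity].
Qed.

Lemma Bnorm_bound T v : norm (T v) <= Bnorm T * norm v.
Proof.
destruct (Req_dec (norm v) 0) as [h|h].
{ apply norm_eq_zero in h; rewrite h, op_zero.
  right; rewrite vnorm_zero; symmetry.
  replace (norm _) with 0 by (symmetry; apply vnorm_zero); ring. }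
pose proof (norm_ge_0 v).
assert (p : 0 < norm v) by lra.
assert (e : norm (T (scal (/ norm v) v)) <= Bnorm T).
{ apply (proj1 (Bnorm_finite T)); eexists; split; [|reflexivity].
  rewrite vnorm_scal; rewrite Rabs_pos_eq.
  - right; now field.
  - left; now apply Rinv_0_lt_compat. }
rewrite op_scal, vnorm_scal in e.
rewrite Rabs_pos_eq in e by (left; now apply Rinv_0_lt_compat).
apply (Rmult_le_compat_r (norm v)) in e; [|lra].
replace (/ norm v * norm (T v) * norm v) with (norm (T v)) in e; [exact e|].
now field.
Qed.

Lemma Bnorm_le T (M : R) :
  0 <= M -> (forall v, norm (T v) <= M * norm v) -> Bnorm T <= M.
Proof.
intros M0 hM.
apply (proj2 (Bnorm_finite T) (Finite M)); intros x [v [hv ->]]; simpl.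
eapply Rle_trans; [apply hM|].
rewrite <- (Rmult_1_r M) at 2; now apply Rmult_le_compat_l.
Qed.

Lemma BplusC T S : Bplus T S = Bplus S T.
Proof. apply BOp_eq; intro v; apply plus_comm. Qed.

Lemma BplusA T S (Q : BOp V) : Bplus T (Bplus S Q) = Bplus (Bplus T S) Q.
Proof. apply BOp_eq; intro v; apply plus_assoc. Qed.

Lemma Bplus0 T : Bplus T Bzero = T.
Proof. apply BOp_eq; intro v; apply plus_zero_r. Qed.

Lemma BplusN T : Bplus T (Bopp T) = Bzero.
Proof.
apply BOp_eq; intro v; simpl.
rewrite scalN1; exact (plus_opp_r (T v)).
Qed.

Definition BOp_AbelianMonoid_mixin : AbelianMonoid.mixin_of (BOp V) :=
  @AbelianMonoid.Mixin (BOp V) Bplus Bzero BplusC BplusA Bplus0.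

Canonical BOp_AbelianMonoid : AbelianMonoid :=
  AbelianMonoid.Pack (BOp V) BOp_AbelianMonoid_mixin (BOp V).

Definition BOp_AbelianGroup_mixin : AbelianGroup.mixin_of BOp_AbelianMonoid :=
  @AbelianGroup.Mixin BOp_AbelianMonoid Bopp BplusN.

Canonical BOp_AbelianGroup : AbelianGroup :=
  AbelianGroup.Pack (BOp V) (AbelianGroup.Class _ _ BOp_AbelianGroup_mixin)
    (BOp V).

Definition BOp_Ring_mixin : Ring.mixin_of BOp_AbelianGroup.
Proof.
refine (@Ring.Mixin BOp_AbelianGroup Bcomp Bone _ _ _ _ _);
  intros; apply BOp_eq; intro; try reflexivity.
apply op_plus.
Defined.

Canonical BOp_Ring : Ring :=
  Ring.Pack (BOp V) (Ring.Class _ _ BOp_Ring_mixin) (BOp V).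

Definition BOp_ModuleSpace_mixin : ModuleSpace.mixin_of R_Ring BOp_AbelianGroup.
Proof.
refine (@ModuleSpace.Mixin R_Ring BOp_AbelianGroup Bscal _ _ _ _).
- intros a b T; apply BOp_eq; intro v.
  exact (scal_assoc (K := R_Ring) a b (T v)).
- intros T; apply BOp_eq; intro v; exact (scal_one (K := R_Ring) (T v)).
- intros a T S; apply BOp_eq; intro v.
  exact (scal_distr_l (K := R_Ring) a (T v) (S v)).
- intros a b T; apply BOp_eq; intro v.
  exact (scal_distr_r (K := R_Ring) a b (T v)).
Defined.

Canonical BOp_ModuleSpace : ModuleSpace R_Ring :=
  ModuleSpace.Pack R_Ring (BOp V)
    (ModuleSpace.Class R_Ring _ _ BOp_ModuleSpace_mixin) (BOp V).

Lemma minusE T S v : (minus T S : BOp V) v = minus (T v) (S v).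
Proof.
change (plus (T v) (scal (-1) (S v)) = minus (T v) (S v)).
now rewrite scalN1.
Qed.

Lemma Bnorm_triangle T S : Bnorm (plus T S) <= Bnorm T + Bnorm S.
Proof.
apply Bnorm_le.
- pose proof (Bnorm_ge0 T); pose proof (Bnorm_ge0 S); lra.
- intro v; eapply Rle_trans; [apply vnorm_triangle|].
  pose proof (Bnorm_bound T v); pose proof (Bnorm_bound S v); lra.
Qed.

Lemma Bnorm_scal (r : R) T : Bnorm (scal r T) <= Rabs r * Bnorm T.
Proof.
apply Bnorm_le.
- apply Rmult_le_pos; [apply Rabs_pos|apply Bnorm_ge0].
- intro v; change (norm (scal r (T v)) <= Rabs r * Bnorm T * norm v).
  rewrite vnorm_scal, Rmult_assoc.
  apply Rmult_le_compat_l; [apply Rabs_pos|apply Bnorm_bound].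
Qed.

Lemma Bnorm_eq0 T : Bnorm T = 0 -> T = zero.
Proof.
intro h; apply BOp_eq; intro v.
change (T v = (zero : V)); apply (norm_eq_zero (V := V)).
pose proof (Bnorm_bound T v); pose proof (norm_ge_0 (T v)).
rewrite h in *; lra.
Qed.

Definition Bball T (e : R) S : Prop := Bnorm (minus S T) < e.

Lemma Bball_center T (e : posreal) : Bball T e T.
Proof.
unfold Bball; rewrite minus_eq_zero.
apply Rle_lt_trans with 0; [|apply cond_pos].
apply Bnorm_le; [lra|]; intro v.
change (norm (zero : V) <= 0 * norm v); rewrite vnorm_zero; lra.
Qed.

Lemma Bball_sym T S e : Bball T e S -> Bball S e T.
Proof.
unfold Bball; intro h; eapply Rle_lt_trans; [|exact h].
apply Bnorm_le; [apply Bnorm_ge0|].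
intro v; rewrite minusE, <- vnorm_opp, opp_minus, <- minusE.
apply Bnorm_bound.
Qed.

Lemma Bball_triangle T S (Q : BOp V) e1 e2 :
  Bball T e1 S -> Bball S e2 Q -> Bball T (e1 + e2) Q.
Proof.
unfold Bball; intros h1 h2.
rewrite (minus_trans S Q T).
eapply Rle_lt_trans; [apply Bnorm_triangle|]; lra.
Qed.

Definition BOp_UniformSpace_mixin : UniformSpace.mixin_of (BOp V) :=
  @UniformSpace.Mixin (BOp V) zero Bball Bball_center Bball_sym Bball_triangle.

Canonical BOp_UniformSpace : UniformSpace :=
  UniformSpace.Pack (BOp V) BOp_UniformSpace_mixin (BOp V).

Canonical BOp_NormedModuleAux : NormedModuleAux R_AbsRing :=
  NormedModuleAux.Pack R_AbsRing (BOp V)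
    (NormedModuleAux.Class R_AbsRing _
       (ModuleSpace.class R_Ring BOp_ModuleSpace) BOp_UniformSpace_mixin) (BOp V).

Lemma Bnorm_compat1 T S (e : R) : Bnorm (minus S T) < e -> ball T e S.
Proof. easy. Qed.

Lemma Bnorm_compat2 T S (e : posreal) : ball T e S -> Bnorm (minus S T) < 1 * e.
Proof. now rewrite Rmult_1_l. Qed.

Definition BOp_NormedModule_mixin :
  NormedModule.mixin_of R_AbsRing BOp_NormedModuleAux :=
  @NormedModule.Mixin R_AbsRing BOp_NormedModuleAux Bnorm 1
    Bnorm_triangle Bnorm_scal Bnorm_compat1 Bnorm_compat2 Bnorm_eq0.

Canonical BOp_NormedModule : NormedModule R_AbsRing :=
  NormedModule.Pack R_AbsRing (BOp V)
    (NormedModule.Class R_AbsRing _ _ BOp_NormedModule_mixin) (BOp V).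

Section Limit.
Variable F : (BOp V -> Prop) -> Prop.
Hypothesis HF : ProperFilter F.
Hypothesis cF : cauchy F.

Let L v : V := lim (filtermap (fun T : BOp V => T v) F).

Lemma limit_near v (e : R) : 0 < e -> F (fun T => norm (minus (T v) (L v)) < e).
Proof.
intro he.
assert (hf : 0 < norm_factor (V := V)) by apply norm_factor_gt_0.
assert (he' : 0 < e / norm_factor (V := V)) by now apply Rdiv_lt_0_compat.
assert (h : F (fun T => ball (L v) (mkposreal _ he') (T v))).
{ apply (complete_cauchy (filtermap (fun T : BOp V => T v) F)).
  - now apply filtermap_proper_filter.
  - intro d.
    assert (hv : 0 < norm v + 1) by (pose proof (norm_ge_0 v); lra).
    assert (hd : 0 < d / (norm v + 1))
      by (apply Rdiv_lt_0_compat; [apply cond_pos|exact hv]).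
    destruct (cF (mkposreal _ hd)) as [T0 h0]; exists (T0 v).
    unfold filtermap; revert h0; apply filter_imp; intros T hT.
    change (Bnorm (minus T T0) < d / (norm v + 1)) in hT.
    apply (norm_compat1 (V := V)).
    rewrite <- minusE.
    eapply Rle_lt_trans; [apply Bnorm_bound|].
    apply Rle_lt_trans with (d / (norm v + 1) * norm v).
    + apply Rmult_le_compat_r; [apply norm_ge_0|lra].
    + apply Rlt_le_trans with (d / (norm v + 1) * (norm v + 1)).
      * apply Rmult_lt_compat_l; lra.
      * right; field; lra. }
revert h; apply filter_imp; intros T hT.
apply (norm_compat2 (V := V)) in hT; simpl in hT.
replace (norm_factor * (e / norm_factor)) with e in hT; [exact hT|field; lra].
Qed.

Lemma limit_plus u v : L (plus u v) = plus (L u) (L v).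
Proof.
apply (eq_of_dist_le (V := V)); intros e he.
assert (h3 : 0 < e / 3) by lra.
destruct (filter_ex _ (filter_and _ _ (limit_near (plus u v) h3)
  (filter_and _ _ (limit_near u h3) (limit_near v h3)))) as [T [h1 [h2 h4]]].
eapply Rle_trans; [apply (dist_trans (V := V)) with (v := T (plus u v))|].
pose proof (dist_plus (V := V) (T u) (T v) (L u) (L v)) as h.
rewrite op_plus in h1 |- *.
replace e with (e / 3 + (e / 3 + e / 3)) by field.
apply Rplus_le_compat; [now apply Rlt_le|].
eapply Rle_trans; [exact h|].
apply Rplus_le_compat; now apply Rlt_le.
Qed.

Lemma minus_rmul u v s : minus (rmul u s) (rmul v s) = rmul (minus u v) s.
Proof.
change (plus (rmul u s) (opp (rmul v s)) = rmul (plus u (opp v)) s).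
now rewrite rmulDl, <- !scalN1, rmul_scal.
Qed.

Lemma limit_rmul v s : L (rmul v s) = rmul (L v) s.
Proof.
apply (eq_of_dist_le (V := V)); intros e he.
assert (hs : 0 < norm s + 1) by (pose proof (norm_ge_0 s); lra).
assert (h2 : 0 < e / 2) by lra.
assert (h2' : 0 < e / 2 / (norm s + 1)) by now apply Rdiv_lt_0_compat.
destruct (filter_ex _ (filter_and _ _ (limit_near (rmul v s) h2)
  (limit_near v h2'))) as [T [h1 h3]].
eapply Rle_trans; [apply (dist_trans (V := V)) with (v := T (rmul v s))|].
apply Rle_trans with (e / 2 + e / 2 / (norm s + 1) * (norm s + 1)).
- apply Rplus_le_compat; [now apply Rlt_le|].
  rewrite op_rmul, minus_rmul, norm_rmul.
  apply Rmult_le_compat; try apply norm_ge_0; [now apply Rlt_le|lra].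
- right; field; lra.
Qed.

Lemma limit_dist (e : R) T0 :
  F (fun T => Bnorm (minus T T0) < e) ->
  forall v, norm (minus (T0 v) (L v)) <= e * norm v.
Proof.
intros h v; apply le_epsilon; intros d hd.
destruct (filter_ex _ (filter_and _ _ h (limit_near v hd))) as [T [h1 h2]].
eapply Rle_trans; [apply (dist_trans (V := V)) with (v := T v)|].
apply Rplus_le_compat; [|now apply Rlt_le].
rewrite <- minusE; eapply Rle_trans; [apply Bnorm_bound|].
apply Rmult_le_compat_r; [apply norm_ge_0|lra].
Qed.

Lemma limit_bounded : exists M, forall v, norm (L v) <= M * norm v.
Proof.
destruct (cF (mkposreal 1 Rlt_0_1)) as [T0 h0].
destruct (op_bounded T0) as [M hM].
exists (M + 1); intro v.
pose proof (limit_dist h0 v) as h; simpl in h.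
pose proof (norm_le_dist (V := V) (L v) (T0 v)) as h1.
specialize (hM v).
eapply Rle_trans; [exact h1|].
eapply Rle_trans; [apply Rplus_le_compat; [exact h|exact hM]|].
rewrite Rmult_plus_distr_r; right; apply Rplus_comm.
Qed.

Lemma BOp_cauchy_limit : exists l, forall e : posreal, F (ball l e).
Proof.
exists {| op := L; op_plus := limit_plus; op_rmul := limit_rmul;
          op_bounded := limit_bounded |}.
intro e.
assert (h3 : 0 < e / 3) by (pose proof (cond_pos e); lra).
destruct (cF (mkposreal _ h3)) as [T0 h0].
change (F (fun T => Bnorm (minus T T0) < e / 3)) in h0.
generalize h0; apply filter_imp; intros T hT.
match goal with |- ball ?l _ _ => change (Bnorm (minus T l) < e) end.
pose proof (cond_pos e).
apply Rle_lt_trans with (e / 3 + e / 3); [|lra].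
apply Bnorm_le; [lra|]; intro v.
rewrite minusE; simpl.
eapply Rle_trans; [apply (dist_trans (V := V)) with (v := T0 v)|].
rewrite Rmult_plus_distr_r; apply Rplus_le_compat.
- rewrite <- (vnorm_opp (minus _ _)), opp_minus.
  rewrite <- minusE; eapply Rle_trans; [apply Bnorm_bound|].
  apply Rmult_le_compat_r; [apply norm_ge_0|lra].
- now apply limit_dist.
Qed.

End Limit.

Canonical BOp_CompleteSpace : CompleteSpace :=
  CompleteSpace.Pack (BOp V)
    (CompleteSpace.Class _ _ (complete_mixin BOp_cauchy_limit)) (BOp V).
Canonical BOp_CompleteNormedModule : CompleteNormedModule R_AbsRing :=
  CompleteNormedModule.Pack R_AbsRing (BOp V)
    (CompleteNormedModule.Class R_AbsRing _
       (NormedModule.class R_AbsRing BOp_NormedModule)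
       (complete_mixin BOp_cauchy_limit)) (BOp V).

Definition is_inverse T S : Prop := mult T S = one /\ mult S T = one.

Definition invertible T : Prop := exists S, is_inverse T S.

(* Unspecified when [T] is not invertible. *)
Definition op_inv T : BOp V := epsilon (inhabits zero) (is_inverse T).

Definition Q_op T s : BOp V :=
  plus (minus (mult T T) (scal (2 * qre s) T)) (scal (norm s ^ 2) (one : BOp V)).

Definition S_spectrum T s : Prop := ~ invertible (Q_op T s).

Definition S_resolvent_set T s : Prop := ~ S_spectrum T s.

Definition SL_inv s T : BOp V :=
  opp (mult (op_inv (Q_op T s)) (minus T (Blmul (qconj s) one))).

Definition SR_inv s T : BOp V :=
  opp (mult (minus T (Blmul (qconj s) one)) (op_inv (Q_op T s))).

Definition riesz_P T (I : quat) (G : list (jordan_curve I)) : BOp V :=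
  scal (/ (2 * PI)) (contour_integral G (fun s dsI => Brmul (SL_inv s T) dsI)).

Definition riesz_T T (I : quat) (G : list (jordan_curve I)) : BOp V :=
  scal (/ (2 * PI))
    (contour_integral G (fun s dsI => Brmul (Brmul (SL_inv s T) dsI) s)).

End Operators.

(* Main.v *)
Require Import Defs.
From Stdlib Require Import Reals List.
From Coquelicot Require Import Coquelicot.
From Stdlib Require Import Lra ssreflect Classical ClassicalEpsilon.
Open Scope R_scope.

(* Write [C_I] for the slice.  Through [X.z := X L_z] the real Banach algebra [B(V)]
   is a complex Banach space on which [M X := T X] is linear, and
   [S_L^{-1}(s,T) = (s - M)^{-1} 1] for [s] in [C_I].  So [P = p 1] for the Riesz
   projector [p] of [M].

   Off the cycle, [p (z - M)^{-1} = n(z) (z - M)^{-1} - F(z)], where [n] is the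
   winding number and [F] the Cauchy transform of the resolvent.  Hence
   [(p^2 - p) (z - M)^{-1}] extends across the spectrum to an entire function
   vanishing at infinity, and is zero by Liouville's theorem: [p^2 = p].
   In the same way [p = 0] as soon as [n = 0] near the spectrum.  Applied to the
   cycle completed by its complex conjugate, which has opposite winding numbers
   since [U] is axially symmetric, this lets one replace the integrand of [p] by
   its average with its conjugate, which has real coefficients: [p X = P X].
   Therefore [P^2 = p (p 1) = P] and [P T = p T = T (p 1) = T P].  Finally
   [S_L^{-1} s - T S_L^{-1} = 1] integrates to [T_j = T P_j], because [ds_I] has
   integral zero on closed curves, and (2) follows from the resolvent equations. *)

(** * Complex Banach spaces *)

Record complex_banach : Type := {
  cb_space :> CompleteNormedModule R_AbsRing;
  cscal : C -> cb_space -> cb_space;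
  cscal_plus_r : forall z u v, cscal z (plus u v) = plus (cscal z u) (cscal z v);
  cscal_plus_l : forall z w u, cscal (z + w)%C u = plus (cscal z u) (cscal w u);
  cscal_mult : forall z w u, cscal z (cscal w u) = cscal (z * w)%C u;
  cscal_real : forall (r : R) u, cscal (RtoC r) u = scal r u;
  cscal_norm : forall z u, norm (cscal z u) <= Cmod z * norm u
}.
Arguments cscal {_} _ _.

Section Square_zero_extension.
Variable E : complex_banach.
Implicit Types (u v : E) (z : C).

(* The square-zero extension of [C] by [E] is a commutative ring, so [ring]
   decides identities in the complex vector space [E]. *)
Record sqz : Type := Sqz { sc_part : C; vec_part : E }.
Definition sqz_add (p q : sqz) :=
  Sqz (sc_part p + sc_part q)%C (plus (vec_part p) (vec_part q)).
Definition sqz_mul (p q : sqz) :=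
  Sqz (sc_part p * sc_part q)%C
    (plus (cscal (sc_part p) (vec_part q)) (cscal (sc_part q) (vec_part p))).
Definition sqz_opp (p : sqz) := Sqz (- sc_part p)%C (opp (vec_part p)).
Definition sc z := Sqz z zero.
Definition vec u := Sqz 0 u.

Lemma cscal_1 u : cscal 1 u = u.
Proof. rewrite cscal_real. exact: (scal_one (K := R_Ring)). Qed.

Lemma cscal_0l u : cscal 0 u = zero.
Proof. rewrite cscal_real. exact: (scal_zero_l (K := R_Ring)). Qed.

Lemma cscal_0r z : cscal z (zero : E) = zero.
Proof. by rewrite -(cscal_0l zero) cscal_mult Cmult_0_r. Qed.

Lemma sqz_ring_theory :
  ring_theory (sc 0) (sc 1) sqz_add sqz_mul
    (fun p q => sqz_add p (sqz_opp q)) sqz_opp eq.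
Proof.
split.
- by move=> [a u]; rewrite /sqz_add /= Cplus_0_l plus_zero_l.
- by move=> [a u] [b v]; rewrite /sqz_add /= Cplus_comm plus_comm.
- by move=> [a u] [b v] [c w]; rewrite /sqz_add /= Cplus_assoc plus_assoc.
- by move=> [a u]; rewrite /sqz_mul /= Cmult_1_l cscal_1 cscal_0r plus_zero_r.
- by move=> [a u] [b v]; rewrite /sqz_mul /= Cmult_comm plus_comm.
- move=> [a u] [b v] [c w]; rewrite /sqz_mul /= Cmult_assoc.
  rewrite !cscal_plus_r !cscal_mult plus_assoc.
  by rewrite (Cmult_comm c a) (Cmult_comm c b).
- move=> [a u] [b v] [c w]; rewrite /sqz_mul /sqz_add /= Cmult_plus_distr_r.
  rewrite !cscal_plus_r cscal_plus_l -!plus_assoc; f_equal; f_equal.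
  by rewrite plus_assoc (plus_comm (cscal b w)) -plus_assoc.
- done.
- by move=> [a u]; rewrite /sqz_add /= Cplus_opp_r plus_opp_r.
Qed.

Lemma vec_inj u v : vec u = vec v -> u = v.
Proof. by case. Qed.
Lemma vec_plus u v : vec (plus u v) = sqz_add (vec u) (vec v).
Proof. by rewrite /sqz_add /vec /= Cplus_0_l. Qed.
Lemma vec_opp u : vec (opp u) = sqz_opp (vec u).
Proof. by rewrite /sqz_opp /vec /= Copp_0. Qed.
Lemma vec_minus u v : vec (minus u v) = sqz_add (vec u) (sqz_opp (vec v)).
Proof. by rewrite /minus vec_plus vec_opp. Qed.
Lemma vec_zero : vec zero = sc 0.
Proof. done. Qed.
Lemma vec_cscal z u : vec (cscal z u) = sqz_mul (sc z) (vec u).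
Proof. by rewrite /sqz_mul /vec /= Cmult_0_r cscal_0l plus_zero_r. Qed.
Lemma vec_scal (r : R) u : vec (scal r u) = sqz_mul (sc r) (vec u).
Proof. by rewrite -vec_cscal cscal_real. Qed.
Lemma sc_plus z w : sc (z + w)%C = sqz_add (sc z) (sc w).
Proof. by rewrite /sqz_add /sc /= plus_zero_l. Qed.
Lemma sc_opp z : sc (- z)%C = sqz_opp (sc z).
Proof. by rewrite /sqz_opp /sc /= opp_zero. Qed.
Lemma sc_minus z w : sc (z - w)%C = sqz_add (sc z) (sqz_opp (sc w)).
Proof. by rewrite /Cminus sc_plus sc_opp. Qed.
Lemma sc_mult z w : sc (z * w)%C = sqz_mul (sc z) (sc w).
Proof. by rewrite /sqz_mul /sc /= !cscal_0r plus_zero_l. Qed.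

End Square_zero_extension.

Ltac cmodule :=
  apply: vec_inj;
  rewrite ?(vec_plus, vec_opp, vec_minus, vec_zero, vec_cscal, vec_scal)
    ?(sc_plus, sc_opp, sc_minus, sc_mult); ring.

Lemma locally_Cmod (z : C) (P : C -> Prop) :
  locally z P <-> exists d : R, 0 < d /\ forall w, Cmod (w - z)%C < d -> P w.
Proof.
split.
- case=> e he; exists e; split; first exact: cond_pos.
  by move=> w hw; apply: he; apply: C_NormedModule_mixin_compat1.
- case=> d [d0 hd]; have d2 : 0 < d / 2 by lra.
  exists (mkposreal _ d2) => w hw; apply: hd.
  have := C_NormedModule_mixin_compat2 _ _ _ hw.
  have h2 : sqrt 2 < 2.
  { rewrite -{2}(sqrt_square 2); [|lra]. apply: sqrt_lt_1; lra. }
  move=> /= h; apply: Rlt_le_trans h _; rewrite /minus; nra.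
Qed.

Lemma compact_rectangle_bound (a b a' b' : R) (P : R -> R -> R -> Prop) :
  (forall x y m m', P x y m -> m <= m' -> P x y m') ->
  (forall u v, a <= u <= b -> a' <= v <= b' ->
     exists m d, 0 < d /\
       forall x y, Rabs (x - u) < d -> Rabs (y - v) < d -> P x y m) ->
  exists m, forall x y, a <= x <= b -> a' <= y <= b' -> P x y m.
Proof.
move=> mono hf.
have hd : forall u v, exists d : posreal, a <= u <= b -> a' <= v <= b' ->
    forall x y, Rabs (x - u) < d -> Rabs (y - v) < d -> P x y (/ d).
{ move=> u v.
  case: (excluded_middle_informative (a <= u <= b /\ a' <= v <= b')); last first.
  { move=> h; exists (mkposreal 1 Rlt_0_1) => hu hv; by case: h. }
  case=> hu hv; case: (hf u v hu hv) => m [d [d0 h]].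
  have m1 : 0 < 1 + Rabs m by have := Rabs_pos m; lra.
  have dp : 0 < Rmin d (/ (1 + Rabs m)).
  { apply: Rmin_pos => //; exact: Rinv_0_lt_compat. }
  exists (mkposreal _ dp) => _ _ x y /= hx hy.
  have l1 := Rmin_l d (/ (1 + Rabs m)); have l2 := Rmin_r d (/ (1 + Rabs m)).
  apply: mono (h x y _ _) _; try lra.
  apply: Rle_trans (Rle_abs m) _.
  apply: Rle_trans (_ : / / (1 + Rabs m) <= _); first by rewrite Rinv_inv; lra.
  exact: Rinv_le_contravar. }
pose delta u v := proj1_sig (constructive_indefinite_description _ (hd u v)).
have hdelta u v := proj2_sig (constructive_indefinite_description _ (hd u v)).
case: (compactness_value_2d a b a' b' delta) => d h.
exists (/ d) => x y hx hy.
case: (NNPP _ (h x y hx hy)) => u [v [hu [hv [h1 [h2 h3]]]]].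
apply: mono (hdelta u v hu hv x y h1 h2) _.
apply: Rinv_le_contravar h3; exact: cond_pos.
Qed.

Lemma compact_segment_bound (a b : R) (P : R -> R -> Prop) :
  (forall t m m', P t m -> m <= m' -> P t m') ->
  (forall t, a <= t <= b -> exists m, locally t (fun u => P u m)) ->
  exists m, forall t, a <= t <= b -> P t m.
Proof.
move=> mono hf.
case: (compact_rectangle_bound a b 0 0 (fun x _ m => P x m)).
{ by move=> x y; apply: mono. }
{ move=> u v hu hv; case: (hf u hu) => m [d hd].
  exists m, d; split; [exact: cond_pos|move=> x y hx hy; exact: hd]. }
by move=> m hm; exists m => t ht; apply: (hm t 0) => //; lra.
Qed.

Definition in_square (r : R) (z : C) : Prop := Rabs (fst z) <= r /\ Rabs (snd z) <= r.

Lemma locally_bounded_square (r : R) (f : C -> R) :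
  (forall z, in_square r z -> exists m, locally z (fun w => f w <= m)) ->
  exists m, forall z, in_square r z -> f z <= m.
Proof.
move=> hf.
case: (compact_rectangle_bound (- r) r (- r) r (fun x y m => f (x, y) <= m)).
{ move=> x y m m'; exact: Rle_trans. }
{ move=> u v hu hv; case: (hf (u, v)).
  { by split; apply: Rabs_le. }
  move=> m [d hd]; exists m, d; split; first exact: cond_pos.
  by move=> x y hx hy; apply: hd; split. }
move=> m hm; exists m; case=> x y [/= hx hy]; apply: hm; exact/Rabs_le_between.
Qed.

Lemma square_attains_max (r : R) (g : C -> R) :
  0 <= r ->
  (forall z, in_square r z ->
     forall e, 0 < e -> locally z (fun w => g w < g z + e)) ->
  exists z0, in_square r z0 /\ forall z, in_square r z -> g z <= g z0.
Proof.
move=> r0 usc.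
case: (locally_bounded_square r g).
{ move=> z hz; exists (g z + 1).
  apply: filter_imp (usc z hz 1 Rlt_0_1) => w; lra. }
move=> m hm.
case: (completeness (fun y => exists z, in_square r z /\ y = g z)).
{ by exists m => _ [z [hz ->]]; apply: hm. }
{ exists (g 0), 0; split=> //; rewrite /in_square /= Rabs_R0; lra. }
move=> M [ub lub].
apply: NNPP => hno.
have lt z : in_square r z -> g z < M.
{ move=> hz; case: (Rle_lt_or_eq_dec (g z) M) => //; first by apply: ub; exists z.
  move=> e; case: hno; exists z; split=> // w hw; rewrite e; apply: ub; by exists w. }
case: (locally_bounded_square r (fun z => / (M - g z))).
{ move=> z hz; have h := lt z hz; exists (/ ((M - g z) / 2)).
  have e0 : 0 < (M - g z) / 2 by lra.
  apply: filter_imp (usc z hz _ e0) => w hw.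
  apply: Rinv_le_contravar => //; lra. }
move=> k hk.
have k1 : 0 < Rmax k 1 by apply: Rlt_le_trans Rlt_0_1 (Rmax_r _ _).
have : M <= M - / Rmax k 1.
{ apply: lub => _ [z [hz ->]]; have h := lt z hz.
  have := Rle_trans _ _ _ (hk z hz) (Rmax_l k 1).
  move=> /(Rinv_le_contravar _ _ (Rinv_0_lt_compat (M - g z) ltac:(lra))).
  rewrite Rinv_inv; lra. }
have := Rinv_0_lt_compat _ k1; lra.
Qed.

Lemma is_RInt_linear (V W : NormedModule R_AbsRing) (l : V -> W) (f : R -> V) a b If :
  is_linear l -> is_RInt f a b If -> is_RInt (fun t => l (f t)) a b (l If).
Proof.
move=> hl h.
have hc := linear_cont l If hl.
have := filterlim_comp _ _ _ _ _ _ _ _ h hc.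
apply: filterlim_ext => ptd.
rewrite linear_scal //; f_equal.
elim/@SF_cons_ind: ptd => [x|hd s IH]; first exact: linear_zero.
rewrite !Riemann_sum_cons linear_plus // linear_scal //; congr plus; exact: IH.
Qed.

Lemma ex_RInt_linear (V W : NormedModule R_AbsRing) (l : V -> W) (f : R -> V) a b :
  is_linear l -> ex_RInt f a b -> ex_RInt (fun t => l (f t)) a b.
Proof. by move=> hl [y hy]; exists (l y); apply: is_RInt_linear. Qed.

Lemma RInt_linear (V W : CompleteNormedModule R_AbsRing) (l : V -> W) (f : R -> V) a b :
  is_linear l -> ex_RInt f a b -> RInt (fun t => l (f t)) a b = l (RInt f a b).
Proof.
move=> hl hf; apply: is_RInt_unique; apply: is_RInt_linear => //.
exact: RInt_correct.
Qed.

Section Sum_RInt.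
Variable A : Type.
Implicit Types (L : list A).

Definition sum_RInt (V : CompleteNormedModule R_AbsRing) (f : A -> R -> V) L : V :=
  fold_right plus zero (map (fun a => RInt (f a) 0 1) L).

Lemma sum_RInt_ext (V : CompleteNormedModule R_AbsRing) (f h : A -> R -> V) L :
  (forall a, In a L -> forall t, 0 < t < 1 -> f a t = h a t) ->
  sum_RInt V f L = sum_RInt V h L.
Proof.
rewrite /sum_RInt; elim: L => [|a L IH] e //=; f_equal.
- apply: RInt_ext => t; rewrite Rmin_left ?Rmax_right; try lra.
  by apply: e; left.
- by apply: IH => b hb; apply: e; right.
Qed.

Lemma sum_RInt_linear (V W : CompleteNormedModule R_AbsRing) (l : V -> W)
    (f : A -> R -> V) L :
  is_linear l -> (forall a, In a L -> ex_RInt (f a) 0 1) ->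
  sum_RInt W (fun a t => l (f a t)) L = l (sum_RInt V f L).
Proof.
rewrite /sum_RInt => hl; elim: L => [|a L IH] hf /=.
{ symmetry; exact: linear_zero. }
rewrite IH; last by move=> b hb; apply: hf; right.
rewrite (linear_plus l) //; f_equal; apply: RInt_linear => //.
by apply: hf; left.
Qed.

Lemma sum_RInt_plus (V : CompleteNormedModule R_AbsRing) (f h : A -> R -> V) L :
  (forall a, In a L -> ex_RInt (f a) 0 1) -> (forall a, In a L -> ex_RInt (h a) 0 1) ->
  sum_RInt V (fun a t => plus (f a t) (h a t)) L = plus (sum_RInt V f L) (sum_RInt V h L).
Proof.
rewrite /sum_RInt; elim: L => [|a L IH] hf hh /=; first by rewrite plus_zero_l.
rewrite IH; [|by move=> b hb; apply: hf; right|by move=> b hb; apply: hh; right].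
rewrite (RInt_plus (V := V)); [|by apply: hf; left|by apply: hh; left].
rewrite -!plus_assoc; f_equal; rewrite !plus_assoc; f_equal; exact: plus_comm.
Qed.

End Sum_RInt.
Arguments sum_RInt {_ _} _ _.

Lemma continuous_at_dist (U : UniformSpace) (V : NormedModule R_AbsRing) (f : U -> V) x :
  continuous f x <-> forall e, 0 < e -> locally x (fun y => norm (minus (f y) (f x)) < e).
Proof.
split.
- move=> /filterlim_locally_ball_norm h e e0; exact: (h (mkposreal e e0)).
- move=> h; apply/filterlim_locally_ball_norm => e; exact: (h e (cond_pos e)).
Qed.

Lemma lipschitz_continuous (V : NormedModule R_AbsRing) (f : C -> V) (z : C) (m : R) :
  locally z (fun w => norm (minus (f w) (f z)) <= m * Cmod (w - z)%C) -> continuous f z.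
Proof.
move=> h; apply/continuous_at_dist => e e0.
have k0 : 0 < Rmax m 1 by apply: Rlt_le_trans (Rmax_r m 1); lra.
have d0 : 0 < e / Rmax m 1 by apply: Rdiv_lt_0_compat.
have hz : locally z (fun w => Cmod (w - z)%C < e / Rmax m 1).
{ by apply/locally_Cmod; exists (e / Rmax m 1). }
apply: filter_imp (filter_and _ _ h hz) => w [h1 h2].
have h3 : Cmod (w - z) * Rmax m 1 < e by apply/Rlt_div_r.
apply: Rle_lt_trans h1 _; apply: Rle_lt_trans h3; rewrite Rmult_comm.
apply: Rmult_le_compat_l; [exact: Cmod_ge_0|exact: Rmax_l].
Qed.

Lemma Cinv_sub (x y : C) : x <> 0 -> y <> 0 -> (/ x - / y = (y - x) * (/ x * / y))%C.
Proof. move=> hx hy; field; by split. Qed.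

Lemma continuous_Cinv_sub (z s : C) : s <> z ->
  continuous (T := C_UniformSpace) (U := C_UniformSpace) (fun w => / (w - z))%C s.
Proof.
move=> hs.
have h0 : (s - z)%C <> 0 by move=> e; apply: hs; rewrite -(Cplus_0_l z) -e; ring.
have c0 : 0 < Cmod (s - z) by apply/Cmod_gt_0.
have c2 : 0 < Cmod (s - z) / 2 by lra.
set k := / (Cmod (s - z) / 2 * Cmod (s - z)).
apply: (lipschitz_continuous C_R_NormedModule _ s k).
apply/locally_Cmod; exists (Cmod (s - z) / 2); split=> // w hw.
rewrite -Cmod_norm.
have hw2 : Cmod (s - z) / 2 < Cmod (w - z).
{ have := Cmod_triangle (w - z) (- (w - s)).
  replace (w - z + - (w - s))%C with (s - z)%C by ring.
  rewrite Cmod_opp; lra. }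
have w0 : (w - z)%C <> 0 by apply/Cmod_gt_0; lra.
change (Cmod (/ (w - z) - / (s - z)) <= k * Cmod (w - s)).
have -> : (/ (w - z) - / (s - z))%C = ((s - w) * (/ (w - z) * / (s - z)))%C.
{ rewrite Cinv_sub //; congr Cmult; ring. }
rewrite !Cmod_mult !Cmod_inv //.
have -> : Cmod (s - w) = Cmod (w - s) by rewrite -Cmod_opp; f_equal; ring.
rewrite Rmult_comm; apply: Rmult_le_compat_r; first exact: Cmod_ge_0.
rewrite /k Rinv_mult; apply: Rmult_le_compat_r.
- left; exact: Rinv_0_lt_compat.
- apply: Rinv_le_contravar; lra.
Qed.

(* A cycle is a list of pairs [(gamma, kappa)]: a path and a complex weight, so
   that [cycle_integral] is the sum of the integrals of [w (gamma t) kappa t dt]. *)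
Definition cycle : Type := list ((R -> C) * (R -> C)).

Definition on_cycle (G : cycle) (s : C) : Prop :=
  exists g, In g G /\ exists t, 0 <= t <= 1 /\ fst g t = s.

Definition regular_cycle (G : cycle) : Prop :=
  forall g, In g G -> forall t, 0 <= t <= 1 ->
    continuous (U := C_UniformSpace) (fst g) t /\ continuous (U := C_UniformSpace) (snd g) t.

Lemma compact_cycle_bound (G : cycle) (P : C -> R -> Prop) :
  regular_cycle G ->
  (forall s m m', P s m -> m <= m' -> P s m') ->
  (forall s, on_cycle G s -> exists m, locally s (fun w => P w m)) ->
  exists m, forall s, on_cycle G s -> P s m.
Proof.
move=> hG mono; elim: G hG => [|g G IH] hG hP.
{ by exists 0 => s [g [[]]]. }
case: IH.
{ by move=> g' hg'; apply: hG; right. }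
{ move=> s [g' [hg' ht]]; apply: hP; exists g'; split=> //; by right. }
move=> m hm.
case: (compact_segment_bound 0 1 (fun t m => P (fst g t) m)).
{ move=> t; exact: mono. }
{ move=> t ht; case: (hP (fst g t)).
  { exists g; split; [by left|by exists t]. }
  move=> k hk; exists k.
  exact: (proj1 (hG g (or_introl eq_refl) t ht) _ hk). }
move=> m' hm'.
exists (Rmax m m') => s [g' [[<-|hg'] [t [ht <-]]]].
- apply: mono (hm' t ht) _; exact: Rmax_r.
- apply: mono (hm (fst g' t) _) _; last exact: Rmax_l.
  by exists g'; split=> //; exists t.
Qed.

(** * Liouville's theorem *)

Section Complex_banach.
Variable E : complex_banach.
Implicit Types (u v : E) (z : C).
Add Ring sqz_ring : (sqz_ring_theory E).

(* A complex Taylor expansion of order two is all the regularity that the proof of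
   Liouville's theorem below requires. *)
Definition jet (f : C -> E) z : Prop := exists a b m, 0 <= m /\
  locally z (fun w : C =>
    norm (minus (f w) (plus (f z) (plus (cscal (w - z) a) (cscal ((w - z) * (w - z)) b))))
      <= m * Cmod (w - z) ^ 3).

Definition clinear (D : E -> E) : Prop :=
  is_linear D /\ forall z u, D (cscal z u) = cscal z (D u).

Lemma norm_cscal z u : norm (cscal z u) = Cmod z * norm u.
Proof.
apply: Rle_antisym; first exact: cscal_norm.
case: (Req_dec (Cmod z) 0) => [->|h].
{ rewrite Rmult_0_l; exact: norm_ge_0. }
have h0 : 0 < Cmod z by have := Cmod_ge_0 z; lra.
have z0 : z <> 0 by apply/Cmod_gt_0.
apply: (Rmult_le_reg_l (/ Cmod z)); first exact: Rinv_0_lt_compat.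
rewrite -Rmult_assoc Rinv_l // Rmult_1_l -Cmod_inv //.
apply: Rle_trans (cscal_norm _ _ _).
by rewrite cscal_mult Cinv_l // cscal_1; lra.
Qed.

Lemma norm_minus_le u v : norm (minus u v) <= norm u + norm v.
Proof.
rewrite -(norm_opp v); exact: norm_triangle.
Qed.

Lemma norm_plus_le u v : norm (plus u v) <= norm u + norm v.
Proof. exact: norm_triangle. Qed.

Lemma norm_sub_le u v : norm v <= norm u + norm (minus v u).
Proof. apply: Rle_trans (norm_plus_le _ _); right; f_equal; cmodule. Qed.

Lemma clinear_plus D u v : clinear D -> D (plus u v) = plus (D u) (D v).
Proof. case=> h _; exact: linear_plus. Qed.

Lemma clinear_minus D u v : clinear D -> D (minus u v) = minus (D u) (D v).
Proof. case=> h _; exact: linear_minus. Qed.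

Lemma clinear_bound D : clinear D -> exists m, 0 < m /\ forall u, norm (D u) <= m * norm u.
Proof. case=> h _; exact: linear_norm. Qed.

Lemma jet_clinear D f z : clinear D -> jet f z -> jet (fun w => D (f w)) z.
Proof.
move=> hD [a [b [m [m0 h]]]].
case: (clinear_bound D hD) => k [k0 hk].
exists (D a), (D b), (k * m); split; first nra.
apply: filter_imp h => w hw.
rewrite -!(proj2 hD) -!(clinear_plus D) // -clinear_minus //.
apply: Rle_trans (hk _) _.
rewrite Rmult_assoc; apply: Rmult_le_compat_l hw; exact: Rlt_le.
Qed.

Lemma jet_ext_loc f g z : locally z (fun w => f w = g w) -> jet f z -> jet g z.
Proof.
move=> e [a [b [m [m0 h]]]].
exists a, b, m; split=> //.
apply: filter_imp (filter_and _ _ h e) => w [hw <-].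
by rewrite -(locally_singleton _ _ e).
Qed.

Lemma cscal_sub_near z (e : R) : 0 < e -> locally z (fun w : C => Cmod (w - z) < e).
Proof. by move=> e0; apply/locally_Cmod; exists e. Qed.

Lemma jet_continuous f z : jet f z ->
  forall e, 0 < e -> locally z (fun w => norm (minus (f w) (f z)) < e).
Proof.
move=> [a [b [m [m0 h]]]] e e0.
set k := norm a + norm b + m + 1.
have k0 : 0 < k by have := norm_ge_0 a; have := norm_ge_0 b; rewrite /k; lra.
have d0 : 0 < Rmin 1 (e / k) by apply: Rmin_pos; [lra|exact: Rdiv_lt_0_compat].
apply: filter_imp (filter_and _ _ h (cscal_sub_near z _ d0)) => w [hw hd].
have h1 := Rlt_le_trans _ _ _ hd (Rmin_l _ _).
have h2 := Rlt_le_trans _ _ _ hd (Rmin_r _ _).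
set r := minus _ _ in hw.
have -> : minus (f w) (f z) =
  plus r (plus (cscal (w - z) a) (cscal ((w - z) * (w - z)) b)).
{ rewrite /r; cmodule. }
apply: Rle_lt_trans (norm_plus_le _ _) _.
apply: Rle_lt_trans (Rplus_le_compat_l _ _ _ (norm_plus_le _ _)) _.
rewrite !norm_cscal Cmod_mult.
set c := Cmod _ in hw h1 h2 *; have c0 : 0 <= c := Cmod_ge_0 _.
have ck : c * k < e by apply/Rlt_div_r.
move: hw ck (norm_ge_0 a) (norm_ge_0 b); rewrite /k.
move: (norm r) (norm a) (norm b) => x y t hw ck y0 t0.
have cc : c * c <= c by nra.
have ccc : c ^ 3 <= c by nra.
nra.
Qed.

(* [h], [-h], [i h], [- i h] and their squares sum to zero. *)
Lemma mean_four_points f z : jet f z ->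
  exists m, 0 <= m /\ exists d, 0 < d /\ forall h : R, 0 < h < d ->
    4 * norm (f z) <= norm (f (z + h)%C) + norm (f (z - h)%C) +
      norm (f (z + Ci * h)%C) + norm (f (z - Ci * h)%C) + 4 * m * h ^ 3.
Proof.
move=> [a [b [m [m0 /locally_Cmod [d [d0 hd]]]]]].
exists m; split=> //; exists d; split=> // h hh.
have key k : Cmod k = h ->
  exists r : E, norm r <= m * h ^ 3 /\
   f (z + k)%C = plus (f z) (plus (cscal k a) (plus (cscal (k * k) b) r)).
{ move=> hk; have e : (z + k - z)%C = k by ring.
  have := hd (z + k)%C; rewrite e hk => /(_ (proj2 hh)).
  set r := minus _ _ => hr; exists r; split=> //; rewrite /r; cmodule. }
have ch : Cmod h = h by rewrite Cmod_R Rabs_pos_eq; lra.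
have [r1 [n1 e1]] := key h ch.
have [|r2 [n2 e2]] := key (- h)%C; first by rewrite Cmod_opp.
have cih : Cmod (Ci * h) = h by rewrite Cmod_mult Cmod_Ci ch; lra.
have [r3 [n3 e3]] := key (Ci * h)%C cih.
have [|r4 [n4 e4]] := key (- (Ci * h))%C; first by rewrite Cmod_opp.
rewrite /Cminus e1 e2 e3 e4.
set x1 := plus (f z) _ ; set x2 := plus (f z) _; set x3 := plus (f z) _; set x4 := plus (f z) _.
have ii : (Ci * h * (Ci * h))%C = (- (h * h))%C.
{ by apply: injective_projections => /=; ring. }
have ii' : (- (Ci * h) * - (Ci * h))%C = (- (h * h))%C.
{ by rewrite -ii; ring. }
have -> : 4 * norm (f z) = norm (cscal (1 + 1 + 1 + 1)%C (f z)).
{ rewrite norm_cscal -!RtoC_plus Cmod_R Rabs_pos_eq; lra. }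
have -> : cscal (1 + 1 + 1 + 1)%C (f z) =
   minus (plus (plus x1 x2) (plus x3 x4)) (plus (plus r1 r2) (plus r3 r4)).
{ rewrite /x1 /x2 /x3 /x4 ii ii'; cmodule. }
have := norm_minus_le (plus (plus x1 x2) (plus x3 x4)) (plus (plus r1 r2) (plus r3 r4)).
have := norm_plus_le (plus x1 x2) (plus x3 x4).
have := norm_plus_le (plus r1 r2) (plus r3 r4).
have := norm_plus_le x1 x2; have := norm_plus_le x3 x4.
have := norm_plus_le r1 r2; have := norm_plus_le r3 r4.
lra.
Qed.

Lemma Cmod_sub_le z (w : C) : Cmod w <= Cmod z + Cmod (w - z).
Proof. by apply: Rle_trans (Cmod_triangle _ _); right; f_equal; ring. Qed.

Definition vanishes_at_infinity (f : C -> E) : Prop :=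
  forall e, 0 < e -> exists r, forall z, r <= Cmod z -> norm (f z) <= e.

Lemma Cmod_sqr z : Cmod z ^ 2 = fst z ^ 2 + snd z ^ 2.
Proof. by rewrite Cmod2_alt. Qed.

(* Otherwise [|f| + e |z|^2], for small [e], has an interior maximum on some square,
   against [mean_four_points]. *)
Lemma liouville f :
  (forall z, jet f z) -> vanishes_at_infinity f -> forall z, f z = zero.
Proof.
move=> hj hv z1; apply: norm_eq_zero.
set c := norm (f z1).
case: (Rle_lt_or_eq_dec 0 c (norm_ge_0 _)) => // c0; exfalso.
have c2 : 0 < c / 2 by lra.
case: (hv _ c2) => r0 hr0.
pose r := Rmax r0 (Cmod z1 + 1).
have r1 : Cmod z1 < r by have := Rmax_r r0 (Cmod z1 + 1); rewrite -/r; lra.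
have rp : 0 < r by have := Cmod_ge_0 z1; lra.
pose e := c / (8 * r ^ 2).
have e0 : 0 < e by apply: Rdiv_lt_0_compat => //; nra.
have er : e * (2 * r ^ 2) = c / 4 by rewrite /e; field; lra.
have hsq z : Cmod z <= r -> in_square r z.
{ move=> h; split; apply: Rle_trans h.
  - exact: Rle_trans (Rmax_l _ _) (Rmax_Cmod _).
  - exact: Rle_trans (Rmax_r _ _) (Rmax_Cmod _). }
have sqb z : in_square r z -> Cmod z ^ 2 <= 2 * r ^ 2.
{ move=> [h1 h2]; rewrite Cmod_sqr.
  move: h1 h2 => /Rabs_le_between h1 /Rabs_le_between h2; nra. }
pose g z := norm (f z) + e * Cmod z ^ 2.
case: (square_attains_max r g).
{ lra. }
{ move=> z hz d d0.
  have d2 : 0 < d / 2 by lra.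
  pose k := 2 * Cmod z + 1.
  have k0 : 0 < k by have := Cmod_ge_0 z; rewrite /k; lra.
  have ek : 0 < Rmin 1 (d / 2 / (e * k)).
  { apply: Rmin_pos; [lra|]; apply: Rdiv_lt_0_compat => //; nra. }
  apply: filter_imp (filter_and _ _ (jet_continuous f z (hj z) _ d2) (cscal_sub_near z _ ek)).
  move=> w [h1 h2]; rewrite /g.
  have h3 := Rlt_le_trans _ _ _ h2 (Rmin_l _ _).
  have h4 := Rlt_le_trans _ _ _ h2 (Rmin_r _ _).
  have h5 : Cmod (w - z) * (e * k) < d / 2 by apply/Rlt_div_r => //; nra.
  have h6 : Cmod w <= Cmod z + Cmod (w - z).
  { exact: Cmod_sub_le. }
  have h7 : norm (f w) <= norm (f z) + norm (minus (f w) (f z)).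
  { exact: norm_sub_le. }
  move: (Cmod_ge_0 (w - z)) (Cmod_ge_0 z) (Cmod_ge_0 w) h3 h5 h6; rewrite /k.
  move: (Cmod (w - z)) (Cmod z) (Cmod w) => x y t x0 y0 t0 h3 h5 h6.
  have : t ^ 2 <= y ^ 2 + x * (2 * y + 1) by nra.
  nra. }
move=> z0 [hz0 hmax].
have g1 : c <= g z0.
{ apply: Rle_trans (hmax z1 _); last by apply: hsq; lra.
  rewrite /g -/c; have := pow2_ge_0 (Cmod z1); nra. }
have zr : Cmod z0 < r.
{ apply: Rnot_le_lt => h.
  have := hr0 z0 (Rle_trans _ _ _ (Rmax_l _ _) h).
  have := sqb z0 hz0; move: g1; rewrite /g; nra. }
case: (mean_four_points f z0 (hj z0)) => m [m0 [d [d0 hd]]].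
pose h := Rmin (Rmin (d / 2) ((r - Cmod z0))) (e / (m + 1)).
have em : 0 < e / (m + 1) by apply: Rdiv_lt_0_compat; lra.
have h0 : 0 < h by repeat apply: Rmin_pos; lra.
have h1 : h <= d / 2 by apply: Rle_trans (Rmin_l _ _) (Rmin_l _ _).
have h2 : h <= r - Cmod z0 by apply: Rle_trans (Rmin_l _ _) (Rmin_r _ _).
have h3 : h * (m + 1) <= e by apply/Rle_div_r; [lra|exact: Rmin_r].
have inside k : Cmod k = h -> g (z0 + k)%C <= g z0.
{ move=> hk; apply/hmax/hsq; apply: Rle_trans (Cmod_triangle _ _) _; lra. }
have ch : Cmod h = h by rewrite Cmod_R Rabs_pos_eq; lra.
have cih : Cmod (Ci * h) = h by rewrite Cmod_mult Cmod_Ci ch; lra.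
have i1 := inside h ch.
have i2 := inside (- h)%C ltac:(by rewrite Cmod_opp).
have i3 := inside (Ci * h)%C cih.
have i4 := inside (- (Ci * h))%C ltac:(by rewrite Cmod_opp).
have := hd h ltac:(lra).
have sq : Cmod (z0 + h) ^ 2 + Cmod (z0 + - h) ^ 2 + Cmod (z0 + Ci * h) ^ 2
   + Cmod (z0 + - (Ci * h)) ^ 2 = 4 * Cmod z0 ^ 2 + 4 * h ^ 2.
{ rewrite !Cmod_sqr /=; ring. }
move: i1 i2 i3 i4 sq; rewrite /g /Cminus.
have : m * h ^ 3 < e * h ^ 2 by have := pow2_gt_0 h; nra.
nra.
Qed.

(** * Integrals over cycles *)

Lemma cscal_Re_Im z u : cscal z u = plus (scal (Re z) u) (scal (Im z) (cscal Ci u)).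
Proof.
rewrite -!cscal_real cscal_mult -cscal_plus_l; f_equal.
by case: z => x y; apply: injective_projections => /=; ring.
Qed.

Lemma is_linear_cscal z : is_linear (fun u : E => cscal z u).
Proof.
split.
- exact: cscal_plus_r.
- by move=> k u; rewrite -!cscal_real !cscal_mult Cmult_comm.
- exists (Cmod z + 1); split; first by have := Cmod_ge_0 z; lra.
  move=> u; apply: Rle_trans (cscal_norm _ _ _) _.
  have := norm_ge_0 u; nra.
Qed.

Lemma clinear_cscal z : clinear (fun u => cscal z u).
Proof.
split; first exact: is_linear_cscal.
by move=> w u; rewrite !cscal_mult Cmult_comm.
Qed.

Lemma continuous_cscal (U : UniformSpace) (k : U -> C) (f : U -> E) (x : U) :
  continuous (U := C_UniformSpace) k x -> continuous f x ->
  continuous (fun y => cscal (k y) (f y)) x.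
Proof.
move=> hk hf.
apply: (continuous_ext
  (fun y => plus (scal (Re (k y)) (f y)) (scal (Im (k y)) (cscal Ci (f y))))).
{ by move=> y; rewrite -cscal_Re_Im. }
have hc : continuous (fun y => cscal Ci (f y)) x.
{ apply: (continuous_comp f (fun u => cscal Ci u)) => //.
  exact: (linear_cont _ _ (is_linear_cscal Ci)). }
have hre : continuous (fun y => Re (k y)) x.
{ apply: (continuous_comp (V := C_UniformSpace) k Re) => //.
  move: (k x) => [a b]; exact: (continuous_fst (U := R_UniformSpace) (V := R_UniformSpace)). }
have him : continuous (fun y => Im (k y)) x.
{ apply: (continuous_comp (V := C_UniformSpace) k Im) => //.
  move: (k x) => [a b]; exact: (continuous_snd (U := R_UniformSpace) (V := R_UniformSpace)). }
apply: (continuous_plus (V := E)); exact: (continuous_scal (V := E)).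
Qed.

Definition cycle_integral (G : cycle) (w : C -> E) : E :=
  sum_RInt (fun g t => cscal (snd g t) (w (fst g t))) G.

Definition continuous_on_cycle (G : cycle) (w : C -> E) : Prop :=
  forall s, on_cycle G s -> continuous (T := C_UniformSpace) w s.

Lemma on_cycle_tail g (G : cycle) s : on_cycle G s -> on_cycle (g :: G) s.
Proof. by move=> [g' [h ht]]; exists g'; split=> //; right. Qed.

Lemma regular_cycle_tail g (G : cycle) : regular_cycle (g :: G) -> regular_cycle G.
Proof. by move=> h g' hg'; apply: h; right. Qed.

Lemma continuous_on_cycle_tail g (G : cycle) w :
  continuous_on_cycle (g :: G) w -> continuous_on_cycle G w.
Proof. by move=> h s hs; apply: h; apply: on_cycle_tail. Qed.

Lemma on_cycle_head g (G : cycle) t : 0 <= t <= 1 -> on_cycle (g :: G) (fst g t).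
Proof. by move=> ht; exists g; split; [left|exists t]. Qed.

Lemma ex_RInt_integrand (G : cycle) w g :
  regular_cycle G -> continuous_on_cycle G w -> In g G ->
  ex_RInt (fun t => cscal (snd g t) (w (fst g t))) 0 1.
Proof.
move=> hG hw hg; apply: ex_RInt_continuous => t.
rewrite Rmin_left ?Rmax_right; try lra.
move=> ht; case: (hG g hg t ht) => h1 h2.
apply: continuous_cscal => //.
apply: (continuous_comp (V := C_UniformSpace) (fst g) w) => //.
by apply: hw; exists g; split=> //; exists t.
Qed.

Lemma cycle_integral_plus G w w' :
  regular_cycle G -> continuous_on_cycle G w -> continuous_on_cycle G w' ->
  cycle_integral G (fun s => plus (w s) (w' s)) =
  plus (cycle_integral G w) (cycle_integral G w').
Proof.
move=> hG hw hw'; rewrite /cycle_integral -sum_RInt_plus.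
- by apply: sum_RInt_ext => g hg t ht; rewrite cscal_plus_r.
- move=> g hg; exact: ex_RInt_integrand hG hw hg.
- move=> g hg; exact: ex_RInt_integrand hG hw' hg.
Qed.

Lemma cycle_integral_clinear G w D :
  clinear D -> regular_cycle G -> continuous_on_cycle G w ->
  cycle_integral G (fun s => D (w s)) = D (cycle_integral G w).
Proof.
move=> hD hG hw; rewrite /cycle_integral -(sum_RInt_linear _ E E D _ _ (proj1 hD)).
- by apply: sum_RInt_ext => g hg t ht; rewrite (proj2 hD).
- move=> g hg; exact: ex_RInt_integrand hG hw hg.
Qed.

Lemma cycle_integral_ext G w w' :
  (forall s, on_cycle G s -> w s = w' s) -> cycle_integral G w = cycle_integral G w'.
Proof.
move=> h; apply: sum_RInt_ext => g hg t ht; rewrite h //.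
by exists g; split=> //; exists t; split=> //; lra.
Qed.

Lemma cycle_integral_bound G :
  regular_cycle G -> exists m, 0 <= m /\ forall w c,
    continuous_on_cycle G w -> 0 <= c -> (forall s, on_cycle G s -> norm (w s) <= c) ->
    norm (cycle_integral G w) <= m * c.
Proof.
rewrite /cycle_integral /sum_RInt; elim: G => [|g G IH] hG.
{ exists 0; split; first lra; move=> w c _ c0 _ /=.
  rewrite Rmult_0_l; right; exact: (norm_zero (V := E)). }
case: (IH (regular_cycle_tail _ _ hG)) => m [m0 hm].
case: (compact_segment_bound 0 1 (fun t b => Cmod (snd g t) <= b)).
{ move=> t; exact: Rle_trans. }
{ move=> t ht; case: (hG g (or_introl eq_refl) t ht) => _ hc.
  exists (Cmod (snd g t) + 1).
  have /hc : locally (snd g t) (fun z => Cmod z <= Cmod (snd g t) + 1).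
  { apply/locally_Cmod; exists 1; split; first lra.
    move=> z hz; have -> : z = (snd g t + (z - snd g t))%C by ring.
    apply: Rle_trans (Cmod_triangle _ _) _; lra. }
  done. }
move=> b hb.
have b0 : 0 <= b by apply: Rle_trans (hb 0 _); [exact: Cmod_ge_0|lra].
exists (b + m); split; first lra.
move=> w c hw c0 hc /=.
apply: Rle_trans (norm_plus_le _ _) _; rewrite Rmult_plus_distr_r.
apply: Rplus_le_compat; last first.
{ apply: hm => //; first exact: continuous_on_cycle_tail hw.
  by move=> s hs; apply: hc; apply: on_cycle_tail. }
have := norm_RInt_le_const _ 0 1 _ (b * c) Rle_0_1 _
  (RInt_correct _ _ _ (ex_RInt_integrand _ _ g hG hw (or_introl eq_refl))).
rewrite Rminus_0_r Rmult_1_l; apply=> t ht.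
apply: Rle_trans (cscal_norm _ _ _) _.
apply: Rmult_le_compat; [exact: Cmod_ge_0|exact: norm_ge_0|exact: hb|].
by apply: hc; apply: on_cycle_head.
Qed.

Lemma cycle_integral_app G G' w :
  cycle_integral (G ++ G') w = plus (cycle_integral G w) (cycle_integral G' w).
Proof.
rewrite /cycle_integral /sum_RInt; elim: G => [|g G IH] /=; first by rewrite plus_zero_l.
by rewrite IH plus_assoc.
Qed.

Lemma continuous_on_cycle_clinear D G w :
  clinear D -> continuous_on_cycle G w -> continuous_on_cycle G (fun s => D (w s)).
Proof.
move=> hD hw s hs; apply: (continuous_comp w D); first exact: hw.
exact: linear_cont (proj1 hD).
Qed.

Lemma continuous_on_cycle_cscal G (k : C -> C) w :
  (forall s, on_cycle G s -> continuous (T := C_UniformSpace) (U := C_UniformSpace) k s) ->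
  continuous_on_cycle G w -> continuous_on_cycle G (fun s => cscal (k s) (w s)).
Proof. move=> hk hw s hs; apply: continuous_cscal; [exact: hk|exact: hw]. Qed.

Lemma continuous_on_cycle_cauchy_kernel G w z :
  ~ on_cycle G z -> continuous_on_cycle G w ->
  continuous_on_cycle G (fun s => cscal (/ (s - z)) (w s)).
Proof.
move=> hz; apply: continuous_on_cycle_cscal => s hs.
apply: continuous_Cinv_sub => e; apply: hz; by rewrite -e.
Qed.

Lemma clinear_intro (D : E -> E) (m : R) :
  (forall u v, D (plus u v) = plus (D u) (D v)) ->
  (forall z u, D (cscal z u) = cscal z (D u)) ->
  (forall u, norm (D u) <= m * norm u) -> clinear D.
Proof.
move=> h1 h2 h3; split=> //; split=> //.
{ by move=> k u; rewrite -!cscal_real. }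
exists (Rmax m 1); split; first by apply: Rlt_le_trans (Rmax_r m 1); lra.
move=> u; apply: Rle_trans (h3 u) _.
apply: Rmult_le_compat_r; [exact: norm_ge_0|exact: Rmax_l].
Qed.

Lemma clinear_comp (D D' : E -> E) : clinear D -> clinear D' -> clinear (fun u => D (D' u)).
Proof.
move=> [l h] [l' h']; split; first exact: is_linear_comp.
by move=> z u; rewrite h' h.
Qed.

Lemma clinear_sub (D D' : E -> E) : clinear D -> clinear D' ->
  clinear (fun u => minus (D u) (D' u)).
Proof.
move=> hD hD'.
case: (clinear_bound _ hD) => m [m0 hm]; case: (clinear_bound _ hD') => m' [m0' hm'].
apply: (clinear_intro _ (m + m')).
- by move=> u v; rewrite (clinear_plus D) // (clinear_plus D') //; cmodule.
- by move=> z u; rewrite (proj2 hD) (proj2 hD'); cmodule.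
- move=> u; apply: Rle_trans (norm_minus_le _ _) _.
  rewrite Rmult_plus_distr_r; exact: Rplus_le_compat.
Qed.

Section Cauchy_transform.
Variables (G : cycle) (w : C -> E).
Hypothesis hG : regular_cycle G.
Hypothesis hw : continuous_on_cycle G w.

Definition cauchy_transform (z : C) : E :=
  cycle_integral G (fun s => cscal (/ (s - z)) (w s)).

Lemma density_bound : exists b, 0 <= b /\ forall s, on_cycle G s -> norm (w s) <= b.
Proof.
case: (compact_cycle_bound G (fun s b => norm (w s) <= b)) => //.
{ move=> s m m'; exact: Rle_trans. }
{ move=> s hs; exists (norm (w s) + 1).
  have := proj1 (continuous_at_dist _ _ _ _) (hw s hs) 1 Rlt_0_1.
  apply: filter_imp => s' h.
  apply: Rle_trans (norm_sub_le (w s) (w s')) _.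
  apply: Rplus_le_compat_l; exact: Rlt_le. }
move=> b hb; exists (Rmax b 0); split; first exact: Rmax_r.
move=> s hs; exact: Rle_trans (hb s hs) (Rmax_l _ _).
Qed.

Lemma cycle_dist z : ~ on_cycle G z ->
  exists d, 0 < d /\ forall s, on_cycle G s -> d <= Cmod (s - z).
Proof.
move=> hz.
have pos s : on_cycle G s -> 0 < Cmod (s - z).
{ move=> hs; apply/Cmod_gt_0 => e; apply: hz.
  by have <- : s = z by rewrite -(Cplus_0_l z) -e; ring. }
case: (compact_cycle_bound G (fun s b => / Cmod (s - z) <= b)) => //.
{ move=> s m m'; exact: Rle_trans. }
{ move=> s hs; exists (/ (Cmod (s - z) / 2)); have p := pos s hs.
  apply/locally_Cmod; exists (Cmod (s - z) / 2); split; first lra.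
  move=> s' h; apply: Rinv_le_contravar; first lra.
  have := Cmod_triangle (s' - z) (- (s' - s)).
  have -> : (s' - z + - (s' - s))%C = (s - z)%C by ring.
  rewrite Cmod_opp; lra. }
move=> b hb; have b1 : 0 < Rmax b 1 by apply: Rlt_le_trans (Rmax_r b 1); lra.
exists (/ Rmax b 1); split; first exact: Rinv_0_lt_compat.
move=> s hs; rewrite -[Cmod _]Rinv_inv; apply: Rinv_le_contravar.
- apply: Rinv_0_lt_compat; exact: pos.
- exact: Rle_trans (hb s hs) (Rmax_l _ _).
Qed.

Lemma cycle_radius : exists r, 0 <= r /\ forall s, on_cycle G s -> Cmod s <= r.
Proof.
case: (compact_cycle_bound G (fun s b => Cmod s <= b)) => //.
{ move=> s m m'; exact: Rle_trans. }
{ move=> s hs; exists (Cmod s + 1).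
  apply: filter_imp (cscal_sub_near s 1 Rlt_0_1) => s' h.
  apply: Rle_trans (Cmod_sub_le s s') _; lra. }
move=> r hr; exists (Rmax r 0); split; first exact: Rmax_r.
move=> s hs; exact: Rle_trans (hr s hs) (Rmax_l _ _).
Qed.

Lemma cauchy_transform_vanishes : vanishes_at_infinity cauchy_transform.
Proof.
move=> e e0.
case: density_bound => b [b0 hb]; case: cycle_radius => r [r0 hr].
case: (cycle_integral_bound G hG) => m [m0 hm].
exists (r + 1 + m * b / e) => z hz.
have q0 : 0 <= m * b / e by apply: Rdiv_le_0_compat => //; nra.
have far s : on_cycle G s -> Cmod z - r <= Cmod (s - z).
{ move=> hs; have := hr s hs; have := Cmod_sub_le s z.
  have -> : Cmod (z - s) = Cmod (s - z) by rewrite -Cmod_opp; f_equal; ring.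
  lra. }
have zr : 0 < Cmod z - r by lra.
have off : ~ on_cycle G z by move=> hs; have := hr z hs; lra.
apply: Rle_trans (hm _ (b / (Cmod z - r)) _ _ _) _.
- exact: continuous_on_cycle_cauchy_kernel.
- exact: Rdiv_le_0_compat.
- move=> s hs; have f := far s hs.
  apply: Rle_trans (cscal_norm _ _ _) _; rewrite Rmult_comm.
  apply: Rmult_le_compat; [exact: norm_ge_0|exact: Cmod_ge_0|exact: hb|].
  rewrite Cmod_inv; last by apply/Cmod_gt_0; lra.
  apply: Rinv_le_contravar => //.
- have : m * b / e <= Cmod z - r by lra.
  move=> /(Rle_div_l _ _ _ e0) h.
  replace (m * (b / (Cmod z - r))) with (m * b / (Cmod z - r)) by (field; lra).
  apply/Rle_div_l => //; lra.
Qed.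

(* Iterating [1/(s-z') = 1/(s-z) + (z'-z)/((s-z)(s-z'))]. *)
Lemma cauchy_transform_jet z : ~ on_cycle G z -> jet cauchy_transform z.
Proof.
move=> hz.
case: density_bound => b [b0 hb]; case: (cycle_dist z hz) => d [d0 hd].
case: (cycle_integral_bound G hG) => m [m0 hm].
pose W1 s := cscal (/ (s - z)) (w s).
pose W2 s := cscal (/ (s - z)) (W1 s).
pose W3 s := cscal (/ (s - z)) (W2 s).
have c1 : continuous_on_cycle G W1 by apply: continuous_on_cycle_cauchy_kernel.
have c2 : continuous_on_cycle G W2 by apply: continuous_on_cycle_cauchy_kernel.
have c3 : continuous_on_cycle G W3 by apply: continuous_on_cycle_cauchy_kernel.
have i0 : 0 < / d by apply: Rinv_0_lt_compat.
have i2 : 0 < / (d / 2) by apply: Rinv_0_lt_compat; lra.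
pose K := / (d / 2) * (/ d * (/ d * (/ d * b))).
have K0 : 0 <= K by rewrite /K; repeat (apply: Rmult_le_pos; [lra|]).
exists (cycle_integral G W2), (cycle_integral G W3), (m * K).
split; first exact: Rmult_le_pos.
apply/locally_Cmod; exists (d / 2); split; first lra.
move=> z' hz'.
have far s : on_cycle G s -> d / 2 <= Cmod (s - z').
{ move=> hs; have := hd s hs; have := Cmod_triangle (s - z') (z' - z).
  have -> : (s - z' + (z' - z))%C = (s - z)%C by ring.
  lra. }
have off : ~ on_cycle G z'.
{ move=> h; have := far z' h; have -> : (z' - z')%C = 0 by ring.
  rewrite Cmod_0; lra. }
pose W4 s := cscal (/ (s - z')) (W3 s).
have c4 : continuous_on_cycle G W4 by apply: continuous_on_cycle_cauchy_kernel.
have ne s : on_cycle G s -> (s - z)%C <> 0 /\ (s - z')%C <> 0.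
{ move=> hs; have := hd s hs; have := far s hs => h1 h2.
  split; apply/Cmod_gt_0; lra. }
set h := (z' - z)%C.
have e : cauchy_transform z' =
  plus (plus (cycle_integral G W1) (cscal h (cycle_integral G W2)))
    (plus (cscal (h * h) (cycle_integral G W3)) (cscal (h * h * h) (cycle_integral G W4))).
{ rewrite -!(cycle_integral_clinear _ _ _ (clinear_cscal _) hG) //.
  have lin a W : continuous_on_cycle G W -> continuous_on_cycle G (fun s => cscal a (W s)).
  { apply: continuous_on_cycle_clinear; exact: clinear_cscal. }
  rewrite -!cycle_integral_plus //; try exact: lin.
  - apply: cycle_integral_ext => s hs; case: (ne s hs) => n1 n2.
    rewrite /W4 /W3 /W2 /W1.
    have step : (/ (s - z') = / (s - z) + h * (/ (s - z) * / (s - z')))%C.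
    { have -> : h = ((s - z) - (s - z'))%C by rewrite /h; ring.
      field; by split. }
    move: (/ (s - z))%C (/ (s - z'))%C step => y y' step.
    transitivity (cscal (y + h * (y * (y + h * (y * (y + h * (y * y'))))))%C (w s)).
    { by rewrite -!step. }
    cmodule.
  - move=> s hs; apply: (continuous_plus (V := E)); [exact: c1|exact: lin].
  - move=> s hs; apply: (continuous_plus (V := E)); exact: lin. }
rewrite e.
match goal with |- norm ?x <= _ =>
  have -> : x = cscal (h * h * h)%C (cycle_integral G W4) end.
{ rewrite /cauchy_transform -/W1; cmodule. }
rewrite norm_cscal !Cmod_mult.
have : norm (cycle_integral G W4) <= m * K.
{ apply: hm => // s hs; have := hd s hs; have := far s hs => h1 h2.
  case: (ne s hs) => n1 n2.
  have inv : / Cmod (s - z) <= / d by apply: Rinv_le_contravar.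
  have inv0 : 0 < / Cmod (s - z) by apply: Rinv_0_lt_compat; lra.
  rewrite /W4 /W3 /W2 /W1 !norm_cscal !Cmod_inv // /K.
  have nw := norm_ge_0 (w s).
  apply: Rmult_le_compat.
  { left; apply: Rinv_0_lt_compat; lra. }
  { repeat (apply: Rmult_le_pos; first lra); lra. }
  { apply: Rinv_le_contravar; lra. }
  do 3 (apply: Rmult_le_compat => //; try lra; try by repeat (apply: Rmult_le_pos; first lra)).
  exact: hb. }
have c0 := Cmod_ge_0 h.
move: (Cmod h) c0 => x x0 hx.
have : 0 <= x * x * x by repeat apply: Rmult_le_pos.
nra.
Qed.

End Cauchy_transform.

(** * The Riesz projector *)

Section Resolvent.
Variables (M : E -> E) (rho : C -> Prop) (Rs : C -> E -> E).
Hypothesis hM : clinear M.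
Hypothesis rho_open : open (T := C_UniformSpace) rho.
Hypothesis hR : forall z, rho z -> clinear (Rs z).
Hypothesis Rs_right : forall z u, rho z -> minus (cscal z (Rs z u)) (M (Rs z u)) = u.
Hypothesis Rs_left : forall z u, rho z -> Rs z (minus (cscal z u) (M u)) = u.

Lemma resolvent_identity z z' u : rho z -> rho z' ->
  Rs z u = plus (Rs z' u) (cscal (z' - z) (Rs z (Rs z' u))).
Proof.
move=> hz hz'.
rewrite -{1}(Rs_right z' u hz'); set v := Rs z' u.
have -> : minus (cscal z' v) (M v) = plus (minus (cscal z v) (M v)) (cscal (z' - z) v).
{ cmodule. }
by rewrite (clinear_plus (Rs z)) ?Rs_left ?(proj2 (hR z hz)) //; apply: hR.
Qed.

Lemma resolvent_commute z u : rho z -> Rs z (M u) = M (Rs z u).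
Proof.
move=> hz; rewrite -{1}(Rs_right z u hz).
rewrite (clinear_minus M) // (proj2 hM); exact: Rs_left.
Qed.

Lemma resolvent_locally_bounded z : rho z -> exists m, 0 < m /\
  locally (T := C_UniformSpace) z (fun z' => rho z' /\ forall u, norm (Rs z' u) <= m * norm u).
Proof.
move=> hz; case: (clinear_bound _ (hR z hz)) => m [m0 hm].
exists (2 * m); split; first lra.
have d0 : 0 < / (2 * m) by apply: Rinv_0_lt_compat; lra.
apply: filter_imp (filter_and _ _ (rho_open z hz) (cscal_sub_near z _ d0)) => z' [hz' h].
split=> // u.
have hk : Cmod (z' - z) * (2 * m) <= 1 by apply/Rle_div_r; [lra|rewrite /Rdiv Rmult_1_l; lra].
have := hm u; have := hm (Rs z' u).
have e : Rs z' u = minus (Rs z u) (cscal (z' - z) (Rs z (Rs z' u))).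
{ rewrite {1}(resolvent_identity z z' u) //; cmodule. }
have : norm (Rs z' u) <= norm (Rs z u) + Cmod (z' - z) * norm (Rs z (Rs z' u)).
{ rewrite {1}e -norm_cscal; exact: norm_minus_le. }
have := Cmod_ge_0 (z' - z); have := norm_ge_0 (Rs z' u).
move: (norm (Rs z' u)) (norm (Rs z u)) (norm (Rs z (Rs z' u))) (norm u) (Cmod (z' - z)) hk
  => a b c t x hk a0 x0 h1 h2 h3.
have : x * c <= x * (m * a) by apply: Rmult_le_compat_l.
have : x * (2 * m) * a <= 1 * a by apply: Rmult_le_compat_r.
lra.
Qed.

Lemma resolvent_jet z u : rho z -> jet (fun z' => Rs z' u) z.
Proof.
move=> hz; case: (resolvent_locally_bounded z hz) => m [m0 hm].
pose v1 := Rs z u; pose v2 := Rs z v1; pose v3 := Rs z v2.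
exists (opp v2), v3, (m * norm v3); split.
{ apply: Rmult_le_pos; [lra|exact: norm_ge_0]. }
apply: filter_imp hm => z' [hz' hb].
have step v : Rs z' v = plus (Rs z v) (cscal (z - z') (Rs z' (Rs z v))).
{ exact: resolvent_identity. }
match goal with |- norm ?x <= _ =>
  have -> : x = cscal (- ((z' - z) * (z' - z) * (z' - z)))%C (Rs z' v3) end.
{ rewrite (step u) -/v1 (step v1) -/v2 (step v2) -/v3; cmodule. }
rewrite norm_cscal Cmod_opp !Cmod_mult.
have := hb v3; have := Cmod_ge_0 (z' - z).
move: (Cmod (z' - z)) => x x0 h.
have : 0 <= x * x * x by repeat apply: Rmult_le_pos.
nra.
Qed.

Lemma resolvent_vanishes u : forall e, 0 < e -> exists r, forall z,
  rho z -> r <= Cmod z -> norm (Rs z u) <= e.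
Proof.
move=> e e0; case: (clinear_bound _ hM) => m [m0 hm].
exists (m + 1 + norm u / e) => z hz hr.
have u0 := norm_ge_0 u; have v0 := norm_ge_0 (Rs z u).
have q0 : 0 <= norm u / e by apply: Rdiv_le_0_compat.
have h : Cmod z * norm (Rs z u) <= norm u + m * norm (Rs z u).
{ rewrite -norm_cscal.
  have -> : cscal z (Rs z u) = plus u (M (Rs z u)).
  { rewrite -{2}(Rs_right z u hz); cmodule. }
  apply: Rle_trans (norm_plus_le _ _) _; apply: Rplus_le_compat_l; exact: hm. }
have : norm u / e <= Cmod z - m by lra.
move=> /(Rle_div_l _ _ _ e0) h2.
apply: Rnot_lt_le => h3.
nra.
Qed.

(* [f] extends [z |-> D (Rs z u)] to an entire function vanishing at infinity. *)
Lemma resolvent_extension D (U : C -> Prop) (f : C -> E) u :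
  clinear D -> open (T := C_UniformSpace) U -> (forall z, rho z \/ U z) ->
  (forall z, U z -> jet f z) -> vanishes_at_infinity f ->
  (forall z, rho z -> U z -> D (Rs z u) = f z) ->
  forall z, rho z -> D (Rs z u) = zero.
Proof.
move=> hD hU hcov hf hv he.
pose g z := match excluded_middle_informative (rho z) with
  | left _ => D (Rs z u) | right _ => f z end.
have gr z : rho z -> g z = D (Rs z u).
{ by rewrite /g; case: excluded_middle_informative. }
have gu z : U z -> g z = f z.
{ by rewrite /g; case: excluded_middle_informative => // h1 h2; apply: he. }
move=> z hz; rewrite -gr //; apply: liouville => [z'|e e0].
- case: (hcov z') => h.
  + apply: (jet_ext_loc (fun z => D (Rs z u))).
    { apply: filter_imp (rho_open _ h) => s hs; by rewrite gr. }
    apply: (jet_clinear D (fun z => Rs z u)) => //; exact: resolvent_jet.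
  + apply: (jet_ext_loc f); last exact: hf.
    by apply: filter_imp (hU _ h) => s hs; rewrite gu.
- case: (clinear_bound _ hD) => m [m0 hm].
  have em : 0 < e / m by apply: Rdiv_lt_0_compat.
  case: (hv e e0) => r1 h1; case: (resolvent_vanishes u _ em) => r2 h2.
  exists (Rmax r1 r2) => s hs; rewrite /g; case: excluded_middle_informative => h.
  + apply: Rle_trans (hm _) _.
    have := h2 s h (Rle_trans _ _ _ (Rmax_r _ _) hs).
    move=> /(Rle_div_r _ _ _ m0); lra.
  + apply: h1; exact: Rle_trans (Rmax_l _ _) hs.
Qed.

Variable G : cycle.
Hypothesis hG : regular_cycle G.
Hypothesis G_rho : forall s, on_cycle G s -> rho s.
Variable U : C -> Prop.
Hypothesis hU : open (T := C_UniformSpace) U.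
Hypothesis hcov : forall z, rho z \/ U z.
Hypothesis G_off : forall z, U z -> ~ on_cycle G z.
Hypothesis rho_inhabited : exists z, rho z.

Definition riesz_projector u : E := cycle_integral G (fun s => Rs s u).

Lemma continuous_resolvent u : continuous_on_cycle G (fun s => Rs s u).
Proof.
move=> s hs; apply/continuous_at_dist.
by apply: (jet_continuous (fun s => Rs s u)); apply: resolvent_jet; apply: G_rho.
Qed.

Lemma clinear_riesz_projector : clinear riesz_projector.
Proof.
case: (compact_cycle_bound G (fun s b => forall u, norm (Rs s u) <= b * norm u)) => //.
{ move=> s m m' h hm u; apply: Rle_trans (h u) _.
  apply: Rmult_le_compat_r hm; exact: norm_ge_0. }
{ move=> s /G_rho /resolvent_locally_bounded [m [m0 hm]]; exists m.
  by apply: filter_imp hm => s' []. }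
move=> b hb; case: (cycle_integral_bound G hG) => m [m0 hm].
apply: (clinear_intro _ (m * Rmax b 0)).
- move=> u v; rewrite /riesz_projector -cycle_integral_plus //; try exact: continuous_resolvent.
  apply: cycle_integral_ext => s hs; apply: clinear_plus; apply: hR; exact: G_rho.
- move=> z u; rewrite /riesz_projector.
  rewrite -(cycle_integral_clinear _ _ _ (clinear_cscal z) hG); last exact: continuous_resolvent.
  apply: cycle_integral_ext => s hs; apply: (proj2 (hR s _)); exact: G_rho.
- move=> u; rewrite Rmult_assoc; apply: hm; first exact: continuous_resolvent.
  + apply: Rmult_le_pos; [exact: Rmax_r|exact: norm_ge_0].
  + move=> s hs; apply: Rle_trans (hb s hs u) _.
    apply: Rmult_le_compat_r; [exact: norm_ge_0|exact: Rmax_l].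
Qed.

Lemma riesz_projector_commute u : riesz_projector (M u) = M (riesz_projector u).
Proof.
rewrite /riesz_projector -(cycle_integral_clinear _ _ _ hM hG); last exact: continuous_resolvent.
by apply: cycle_integral_ext => s hs; apply: resolvent_commute; apply: G_rho.
Qed.

Lemma riesz_projector_resolvent z u : rho z -> U z ->
  riesz_projector (Rs z u) =
  minus (cycle_integral G (fun s => cscal (/ (s - z)) (Rs z u)))
    (cauchy_transform G (fun s => Rs s u) z).
Proof.
move=> hz /G_off off.
have ck : continuous_on_cycle G (fun s => cscal (/ (s - z)) (Rs z u)).
{ apply: continuous_on_cycle_cauchy_kernel => // s hs; exact: continuous_const. }
have cr : continuous_on_cycle G (fun s => cscal (/ (s - z)) (Rs s u)).
{ apply: continuous_on_cycle_cauchy_kernel => //; exact: continuous_resolvent. }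
have -> : cauchy_transform G (fun s => Rs s u) z =
  opp (cycle_integral G (fun s => cscal (- (1))%C (cscal (/ (s - z)) (Rs s u)))).
{ rewrite (cycle_integral_clinear _ _ _ (clinear_cscal _) hG) //.
  rewrite /cauchy_transform; cmodule. }
rewrite /minus opp_opp -cycle_integral_plus //; last first.
{ apply: (continuous_on_cycle_clinear (cscal (- (1))%C)) => //; exact: clinear_cscal. }
apply: cycle_integral_ext => s hs.
have sz : (s - z)%C <> 0.
{ move=> e; apply: off; by have <- : s = z by rewrite -(Cplus_0_l z) -e; ring. }
rewrite (resolvent_identity s z u) //; last exact: G_rho.
set v := Rs s (Rs z u).
transitivity (cscal (/ (s - z) * (s - z))%C v); last by cmodule.
by rewrite Cinv_l // cscal_1.
Qed.

Lemma cauchy_transform_resolvent_jet z u : U z -> jet (cauchy_transform G (fun s => Rs s u)) z.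
Proof.
move=> /G_off; apply: cauchy_transform_jet => //; exact: continuous_resolvent.
Qed.

Lemma cauchy_transform_resolvent_vanishes u :
  vanishes_at_infinity (cauchy_transform G (fun s => Rs s u)).
Proof. apply: cauchy_transform_vanishes => //; exact: continuous_resolvent. Qed.

Lemma zero_of_resolvent (D : E -> E) : 
  (forall z u, rho z -> D (Rs z u) = zero) -> forall u, D u = zero.
Proof.
move=> h u; case: rho_inhabited => z hz.
by rewrite -(Rs_left z u hz) h.
Qed.

Lemma vanishes_clinear (D : E -> E) f : 
  clinear D -> vanishes_at_infinity f -> vanishes_at_infinity (fun z => D (f z)).
Proof.
move=> /clinear_bound [m [m0 hm]] hf e e0.
have em : 0 < e / m by apply: Rdiv_lt_0_compat.
case: (hf _ em) => r h; exists r => z /h /(Rle_div_r _ _ _ m0) hz.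
apply: Rle_trans (hm _) _; lra.
Qed.

Lemma riesz_projector_zero :
  (forall z u, U z -> cycle_integral G (fun s => cscal (/ (s - z)) u) = zero) ->
  forall u, riesz_projector u = zero.
Proof.
move=> wind; apply: zero_of_resolvent => z u.
apply: (resolvent_extension _ U
  (fun z => cscal (- (1))%C (cauchy_transform G (fun s => Rs s u) z))) => //.
- exact: clinear_riesz_projector.
- move=> z' hz'; apply: (jet_clinear (cscal (- (1))%C)); first exact: clinear_cscal.
  exact: cauchy_transform_resolvent_jet.
- apply: vanishes_clinear; first exact: clinear_cscal.
  exact: cauchy_transform_resolvent_vanishes.
- move=> z' h1 h2; rewrite riesz_projector_resolvent // wind //; cmodule.
Qed.

(* Where the winding number [n] is constant, [P (P (Rs z u)) - P (Rs z u)] equals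
   [(1 - n) F - P F] with [F] the Cauchy transform of the resolvent. *)
Lemma riesz_projector_idempotent (n : C -> C) :
  (forall z, n z = 0 \/ n z = 1) ->
  (forall z, U z -> locally (T := C_UniformSpace) z (fun z' => n z' = n z)) ->
  (forall z u, U z -> cycle_integral G (fun s => cscal (/ (s - z)) u) = cscal (n z) u) ->
  forall u, riesz_projector (riesz_projector u) = riesz_projector u.
Proof.
move=> n01 nloc wind.
have hP := clinear_riesz_projector.
pose D u := minus (riesz_projector (riesz_projector u)) (riesz_projector u).
have hD : clinear D by apply: clinear_sub => //; exact: clinear_comp.
suff D0 u : D u = zero.
{ move=> u; move: (D0 u); rewrite /D => h.
  have -> : riesz_projector (riesz_projector u) =
    plus (minus (riesz_projector (riesz_projector u)) (riesz_projector u)) (riesz_projector u).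
  { cmodule. }
  by rewrite h plus_zero_l. }
move: u; apply: zero_of_resolvent => z u.
pose F z := cauchy_transform G (fun s => Rs s u) z.
have hF : vanishes_at_infinity F by exact: cauchy_transform_resolvent_vanishes.
apply: (resolvent_extension _ U
  (fun z => minus (cscal (1 - n z)%C (F z)) (riesz_projector (F z)))) => //.
- move=> z' hz'.
  apply: (jet_ext_loc (fun w => minus (cscal (1 - n z')%C (F w)) (riesz_projector (F w)))).
  { by apply: filter_imp (nloc _ hz') => s ->. }
  apply: (jet_clinear (fun v => minus (cscal (1 - n z')%C v) (riesz_projector v)) F).
  { apply: clinear_sub => //; exact: clinear_cscal. }
  exact: cauchy_transform_resolvent_jet.
- move=> e e0; have e2 : 0 < e / 2 by lra.
  case: (hF _ e2) => r1 h1; case: (vanishes_clinear _ _ hP hF _ e2) => r2 h2.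
  exists (Rmax r1 r2) => s hs.
  have := h1 s (Rle_trans _ _ _ (Rmax_l _ _) hs).
  have := h2 s (Rle_trans _ _ _ (Rmax_r _ _) hs) => b2 b1.
  apply: Rle_trans (norm_minus_le _ _) _.
  suff : norm (cscal (1 - n s)%C (F s)) <= e / 2 by lra.
  apply: Rle_trans b1; rewrite norm_cscal -{2}(Rmult_1_l (norm (F s))).
  apply: Rmult_le_compat_r; first exact: norm_ge_0.
  case: (n01 s) => ->.
  + replace (1 - 0)%C with (RtoC 1) by ring. rewrite Cmod_1; lra.
  + replace (1 - 1)%C with (RtoC 0) by ring. rewrite Cmod_0; lra.
- move=> z' h1 h2; rewrite /D.
  rewrite (riesz_projector_resolvent z' u) // wind // -/(F z').
  rewrite (clinear_minus riesz_projector) // (proj2 hP).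
  rewrite (riesz_projector_resolvent z' u) // wind // -/(F z').
  case: (n01 z') => ->; cmodule.
Qed.

End Resolvent.

End Complex_banach.
Arguments clinear {_} _.
Arguments cycle_integral {_} _ _.
Arguments continuous_on_cycle {_} _ _.
Arguments clinear_plus {_} _ _ _ _.

Lemma is_derive_vector_unique (V : NormedModule R_AbsRing) (f : R -> V) (x : R) (l l' : V) :
  is_derive f x l -> is_derive f x l' -> l = l'.
Proof.
move=> h h'.
have h0 := is_derive_minus _ _ _ _ _ h h'.
apply: eq_of_dist_le => e e0.
have [d hd] := proj2 h0 x (fun P HP => HP) (mkposreal e e0).
have d2 : 0 < d / 2 by have := cond_pos d; lra.
have hx : (x + d / 2 - x) = d / 2 by ring.
have := hd (x + d / 2).
have -> : minus (x + d / 2) x = d / 2 by exact: hx.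
have -> : forall u v : V, minus (minus (minus u u) (minus v v)) (scal (d / 2) (minus l l')) =
   opp (scal (d / 2) (minus l l')).
{ by move=> u v; rewrite !minus_eq_zero /minus plus_zero_l. }
move=> h1.
have {h1} : norm (opp (scal (d / 2) (minus l l'))) <= e * Rabs (d / 2).
{ apply: h1; apply: (norm_compat1 (V := R_NormedModule)).
  change (Rabs (x + d / 2 - x) < d); rewrite hx Rabs_pos_eq; have := cond_pos d; lra. }
rewrite norm_opp Rabs_pos_eq; last lra.
have e1 : scal (/ (d / 2)) (scal (d / 2) (minus l l')) = minus l l'.
{ rewrite scal_assoc.
  have -> : mult (/ (d / 2)) (d / 2) = one by apply: Rinv_l; lra.
  exact: scal_one. }
move=> h1.
have := norm_scal (K := R_AbsRing) (/ (d / 2)) (scal (d / 2) (minus l l')); rewrite e1 => h2.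
apply: Rle_trans h2 _.
change (Rabs (/ (d / 2)) * norm (scal (d / 2) (minus l l')) <= e).
have i0 : 0 < / (d / 2) by apply: Rinv_0_lt_compat.
rewrite Rabs_pos_eq; last lra.
apply: Rle_trans (Rmult_le_compat_l _ _ _ (Rlt_le _ _ i0) h1) _.
right; field; have := cond_pos d; lra.
Qed.

Lemma quat_norm_sqr (a b c d : R) :
  norm ((a, b, c, d) : quat) ^ 2 = a ^ 2 + b ^ 2 + c ^ 2 + d ^ 2.
Proof.
rewrite quat_normE pow2_sqrt //.
have := pow2_ge_0 a; have := pow2_ge_0 b; have := pow2_ge_0 c; have := pow2_ge_0 d; lra.
Qed.

Lemma qconj_conj (p : quat) : qconj (qconj p) = p.
Proof. move: p => [[[a b] c] d]; by apply: quat_eq; ring. Qed.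

Lemma mult_qconj_l (p : quat) : mult (qconj p) p = qreal (norm p ^ 2).
Proof.
move: p => [[[a b] c] d]; rewrite quat_norm_sqr; by apply: quat_eq; ring.
Qed.

Lemma norm_qconj (p : quat) : norm (qconj p) = norm p.
Proof.
move: p => [[[a b] c] d]; rewrite /qconj !quat_normE; f_equal; ring.
Qed.

Lemma mult_qconj_r (p : quat) : mult p (qconj p) = qreal (norm p ^ 2).
Proof. by rewrite -{1}(qconj_conj p) mult_qconj_l norm_qconj. Qed.

Lemma qre_qconj (p : quat) : qre (qconj p) = qre p.
Proof. by move: p => [[[a b] c] d]. Qed.

Lemma plus_qconj (p : quat) : plus p (qconj p) = qreal (2 * qre p).
Proof.
move: p => [[[a b] c] d]; by apply: quat_eq; cbn; ring.
Qed.

Lemma quat_coord_le (a b c d : R) : let n := norm ((a, b, c, d) : quat) in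
  Rabs a <= n /\ Rabs b <= n /\ Rabs c <= n /\ Rabs d <= n.
Proof.
move=> n.
have n0 : 0 <= n by exact: (norm_ge_0 (V := quat_NormedModule)).
have e := quat_norm_sqr a b c d; rewrite -/n in e.
have := pow2_ge_0 a; have := pow2_ge_0 b; have := pow2_ge_0 c; have := pow2_ge_0 d.
move=> *; split; [|split; [|split]]; apply: Rabs_le; nra.
Qed.

(** * Slices *)

Section Slice.
Variable I : quat.
Hypothesis hI : imag_unit I.

Definition embed (z : C) : quat := slice_point I (fst z) (snd z).

(* Coordinates with respect to [1, I] of the orthogonal projection onto the slice. *)
Definition coord (s : quat) : C :=
  let '(a, b, c, d) := s in let '(_, i, j, k) := I in (a, b * i + c * j + d * k).

Lemma imag_unit_coord : exists i j k, I = (0, i, j, k) /\ i ^ 2 + j ^ 2 + k ^ 2 = 1.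
Proof.
move: hI; move: (I) => [[[a i] j] k] [/= ha hn].
exists i, j, k; rewrite ha; split=> //.
have := quat_norm_sqr a i j k; rewrite hn ha; lra.
Qed.

Lemma embedE i j k : I = (0, i, j, k) ->
  forall z, embed z = (fst z, snd z * i, snd z * j, snd z * k).
Proof.
move=> e z; rewrite /embed /slice_point e.
by apply: quat_eq; cbn; ring.
Qed.

Lemma embed_mult (z w : C) : embed (z * w)%C = mult (embed z) (embed w).
Proof.
case: imag_unit_coord => i [j [k [e n]]]; rewrite !(embedE i j k e).
case: z => x y; case: w => x' y' /=.
apply: quat_eq; try ring.
transitivity (x * x' - y * y' * (i ^ 2 + j ^ 2 + k ^ 2)); [rewrite n|]; ring.
Qed.

Lemma embed_plus (z w : C) : embed (z + w)%C = plus (embed z) (embed w).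
Proof.
case: imag_unit_coord => i [j [k [e n]]]; rewrite !(embedE i j k e).
by apply: quat_eq; cbn; ring.
Qed.

Lemma embed_minus (z w : C) : embed (z - w)%C = minus (embed z) (embed w).
Proof.
case: imag_unit_coord => i [j [k [e n]]]; rewrite !(embedE i j k e).
by apply: quat_eq; cbn; ring.
Qed.

Lemma embed_real (r : R) : embed (RtoC r) = qreal r.
Proof.
case: imag_unit_coord => i [j [k [e n]]]; rewrite !(embedE i j k e).
by apply: quat_eq => /=; ring.
Qed.

Lemma embed_conj (z : C) : embed (Cconj z) = qconj (embed z).
Proof.
case: imag_unit_coord => i [j [k [e n]]]; rewrite !(embedE i j k e).
by apply: quat_eq => /=; ring.
Qed.

Lemma embed_Ci : embed Ci = I.
Proof.
case: imag_unit_coord => i [j [k [e n]]]; rewrite !(embedE i j k e) e.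
by apply: quat_eq => /=; ring.
Qed.

Lemma norm_embed (z : C) : norm (embed z) = Cmod z.
Proof.
case: imag_unit_coord => i [j [k [e n]]]; rewrite !(embedE i j k e).
rewrite quat_normE /Cmod; f_equal.
transitivity (fst z ^ 2 + snd z ^ 2 * (i ^ 2 + j ^ 2 + k ^ 2)); [|rewrite n]; ring.
Qed.

Lemma coord_embed (z : C) : coord (embed z) = z.
Proof.
case: imag_unit_coord => i [j [k [e n]]]; rewrite (embedE i j k e) /coord e.
apply: injective_projections => //=.
transitivity (snd z * (i ^ 2 + j ^ 2 + k ^ 2)); [|rewrite n]; ring.
Qed.

Lemma embed_coord s : slice I s -> embed (coord s) = s.
Proof. move=> [x [y ->]]; by rewrite -[slice_point I x y]/(embed (x, y)) coord_embed. Qed.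

Lemma slice_scal (r : R) s : slice I s -> slice I (scal r s).
Proof.
move=> [x [y ->]]; exists (r * x), (r * y); rewrite /slice_point.
by move: (I) => [[[a b] c] d]; apply: quat_eq; cbn; ring.
Qed.

Lemma slice_embed z : slice I (embed z).
Proof. by exists (fst z), (snd z). Qed.

Lemma is_linear_coord : is_linear (U := quat_NormedModule) (V := C_R_NormedModule) coord.
Proof.
case: imag_unit_coord => i [j [k [e n]]].
split.
- move=> [[[a b] c] d] [[[a' b'] c'] d']; rewrite /coord e.
  by apply: injective_projections; cbn; ring.
- move=> r [[[a b] c] d]; rewrite /coord e.
  by apply: injective_projections; cbn; ring.
- exists 6; split; first lra.
  move=> [[[a b] c] d]; rewrite /coord e -Cmod_norm.
  case: (quat_coord_le a b c d) => ha [hb [hc hd]].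
  set m := norm _ in ha hb hc hd *.
  have m0 : 0 <= m by apply: Rle_trans ha; exact: Rabs_pos.
  apply: Rle_trans (Cmod_2Rmax _) _ => /=.
  have h2 : sqrt 2 <= 2.
  { rewrite -{2}(sqrt_square 2); [|lra]. apply: sqrt_le_1_alt; lra. }
  have h3 : Rmax (Rabs a) (Rabs (b * i + c * j + d * k)) <= 3 * m.
  { have [bi bj] : Rabs i <= 1 /\ Rabs j <= 1 by split; apply: Rabs_le; nra.
    have bk : Rabs k <= 1 by apply: Rabs_le; nra.
    have bound x y : Rabs x <= m -> Rabs y <= 1 -> Rabs (x * y) <= m.
    { move=> hx hy; rewrite Rabs_mult -(Rmult_1_r m).
      apply: Rmult_le_compat => //; exact: Rabs_pos. }
    apply: Rmax_lub; first lra.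
    have := Rabs_triang (b * i + c * j) (d * k); have := Rabs_triang (b * i) (c * j).
    have := bound b i hb bi; have := bound c j hc bj; have := bound d k hd bk; lra. }
  have := sqrt_pos 2; nra.
Qed.

Lemma is_linear_embed_coord : is_linear (U := quat_NormedModule) (V := quat_NormedModule)
  (fun s => embed (coord s)).
Proof.
have [h1 h2 [m [m0 h3]]] := is_linear_coord.
split.
- by move=> s t; rewrite h1 -embed_plus.
- move=> r s; rewrite h2.
  case: imag_unit_coord => i [j [k [e n]]]; rewrite !(embedE i j k e).
  by apply: quat_eq; cbn; ring.
- exists m; split=> // s; rewrite norm_embed Cmod_norm; exact: h3.
Qed.

(* Restricted to interior parameters, where the curve is in the slice on both sides. *)
Lemma velocity_slice (g : jordan_curve I) t : 0 < t < 1 ->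
  embed (coord (velocity g t)) = velocity g t.
Proof.
move=> ht.
have ht' : 0 <= t <= 1 by lra.
have hd := path_derive g ht'.
have h1 : is_derive (V := quat_NormedModule) (fun u => embed (coord (path g u))) t
    (embed (coord (velocity g t))).
{ have hc := filterdiff_comp (path g) (fun s => embed (coord s)) _ _ hd
    (filterdiff_linear _ is_linear_embed_coord).
  refine (filterdiff_ext_lin _ _ _ (hc _) _) => y.
  exact: (linear_scal _ is_linear_embed_coord). }
have h2 : is_derive (V := quat_NormedModule) (path g) t (embed (coord (velocity g t))).
{ apply: is_derive_ext_loc h1.
  apply: (locally_interval _ t 0 1) => [/=|/=|u /= h0 h1]; try lra.
  apply: embed_coord; apply: path_slice; lra. }
exact: is_derive_vector_unique h2 hd.
Qed.

End Slice.

(** * Operators *)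

Section Operators.
Variable V : TwoSidedBanach.
Implicit Types (T S X Y : BOp V) (s : quat).

Lemma Bnorm_mult X Y : norm (mult X Y) <= norm X * norm Y.
Proof.
apply: Bnorm_le; first by apply: Rmult_le_pos; exact: Bnorm_ge0.
move=> v; apply: Rle_trans (Bnorm_bound X (Y v)) _; rewrite Rmult_assoc.
apply: Rmult_le_compat_l; [exact: Bnorm_ge0|exact: Bnorm_bound].
Qed.

Lemma Bnorm_Brmul X s : norm (Brmul X s) <= norm s * norm X.
Proof.
apply: Bnorm_le; first by apply: Rmult_le_pos; [exact: norm_ge_0|exact: Bnorm_ge0].
move=> v; apply: Rle_trans (Bnorm_bound X (lmul s v)) _; rewrite norm_lmul.
by right; change (Bnorm X * (norm s * norm v) = norm s * Bnorm X * norm v); ring.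
Qed.

Lemma Bscal_mult (r : R) X Y : scal r (mult X Y) = mult (scal r X) Y.
Proof. exact: BOp_eq. Qed.

Lemma mult_Bscal (r : R) X Y : mult X (scal r Y) = scal r (mult X Y).
Proof. apply: BOp_eq => v; exact: op_scal. Qed.

Lemma is_linear_Bmult_l X : is_linear (fun Y : BOp V => mult X Y).
Proof.
split.
- move=> Y Z; exact: mult_distr_l.
- move=> r Y; exact: mult_Bscal.
- exists (norm X + 1); split; first by have := Bnorm_ge0 X; rewrite /norm /=; lra.
  move=> Y; apply: Rle_trans (Bnorm_mult X Y) _.
  apply: Rmult_le_compat_r; [exact: Bnorm_ge0|lra].
Qed.

Lemma is_linear_Bmult_r X : is_linear (fun Y : BOp V => mult Y X).
Proof.
split.
- move=> Y Z; exact: mult_distr_r.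
- by move=> r Y; rewrite Bscal_mult.
- exists (norm X + 1); split; first by have := Bnorm_ge0 X; rewrite /norm /=; lra.
  move=> Y; apply: Rle_trans (Bnorm_mult Y X) _; rewrite Rmult_comm.
  apply: Rmult_le_compat_r; [exact: Bnorm_ge0|lra].
Qed.

Lemma norm_pow_n Y n : norm (pow_n Y n) <= norm Y ^ n.
Proof.
elim: n => [|n IH] /=.
{ apply: Bnorm_le => [|v]; first lra; rewrite Rmult_1_l; exact: Rle_refl. }
apply: Rle_trans (Bnorm_mult _ _) _.
apply: Rmult_le_compat_l IH; exact: Bnorm_ge0.
Qed.

Lemma mult_minus_l X Y S : mult (minus X Y) S = minus (mult X S) (mult Y S).
Proof. by rewrite /minus mult_distr_r opp_mult_l. Qed.

Lemma mult_minus_r X Y S : mult S (minus X Y) = minus (mult S X) (mult S Y).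
Proof. by rewrite /minus mult_distr_l opp_mult_r. Qed.

Lemma geometric_sum Y n :
  mult (minus one Y) (sum_n (pow_n Y) n) = minus one (pow_n Y (S n)) /\
  mult (sum_n (pow_n Y) n) (minus one Y) = minus one (pow_n Y (S n)).
Proof.
elim: n => [|n [IH1 IH2]].
{ by rewrite sum_O /= !mult_one_r mult_one_l. }
rewrite sum_Sn mult_distr_l mult_distr_r IH1 IH2 mult_minus_l mult_minus_r.
by rewrite mult_one_l mult_one_r pow_n_comm_1 -!minus_trans.
Qed.

Lemma invertible_one_minus Y : norm Y < 1 -> invertible (minus one Y).
Proof.
move=> hY.
have hg : ex_series (fun n => norm Y ^ n).
{ exists (/ (1 - norm Y)); apply: is_series_geom; rewrite Rabs_pos_eq //; exact: Bnorm_ge0. }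
case: (ex_series_le (V := BOp_CompleteNormedModule V) (pow_n Y) _ (norm_pow_n Y) hg) => L hL.
have hp : filterlim (fun n => minus one (pow_n Y (S n))) eventually (locally (one : BOp V)).
{ apply/filterlim_locally_ball_norm => e.
  have := is_lim_seq_geom (norm Y) ltac:(rewrite Rabs_pos_eq //; exact: Bnorm_ge0).
  move=> /is_lim_seq_spec /(_ e) [N hN]; exists N => n hn.
  have := hN (S n) ltac:(auto with arith).
  rewrite Rminus_0_r => /(Rle_lt_trans _ _ _ (Rle_abs _)) h.
  apply: Rle_lt_trans h; apply: Rle_trans (norm_pow_n Y (S n)).
  rewrite -(norm_opp (pow_n Y (S n))); right; f_equal.
  by rewrite /minus (plus_comm one) -plus_assoc plus_opp_r plus_zero_r. }
exists L; split.
- have h := filterlim_comp _ _ _ _ _ _ _ _ hL (linear_cont _ L (is_linear_Bmult_l (minus one Y))).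
  apply: (filterlim_locally_unique (V := BOp_NormedModule V) _ _ _ h).
  apply: filterlim_ext hp => n; by rewrite (proj1 (geometric_sum Y n)).
- have h := filterlim_comp _ _ _ _ _ _ _ _ hL (linear_cont _ L (is_linear_Bmult_r (minus one Y))).
  apply: (filterlim_locally_unique (V := BOp_NormedModule V) _ _ _ h).
  apply: filterlim_ext hp => n; by rewrite (proj2 (geometric_sum Y n)).
Qed.

Lemma invertible_near X Y S : is_inverse X S -> norm S * norm (minus X Y) < 1 -> invertible Y.
Proof.
move=> [XS SX] h.
have [|L [L1 L2]] := invertible_one_minus (mult S (minus X Y)).
{ exact: Rle_lt_trans (Bnorm_mult _ _) h. }
have e : mult S Y = minus one (mult S (minus X Y)).
{ by rewrite mult_minus_r SX /minus opp_plus opp_opp plus_assoc plus_opp_r plus_zero_l. }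
exists (mult L S); split.
- rewrite -e in L1.
  have h1 : mult Y L = X.
  { by rewrite -(mult_one_l (mult Y L)) -XS -mult_assoc (mult_assoc S) L1 mult_one_r. }
  by rewrite mult_assoc h1.
- by rewrite -mult_assoc e.
Qed.

End Operators.

Section Operator_resolvent.
Variables (V : TwoSidedBanach) (I : quat).
Hypothesis hI : imag_unit I.
Implicit Types (T S X Y : BOp V) (s : quat).

Lemma Brmul_plus_r X s t : Brmul X (plus s t) = plus (Brmul X s) (Brmul X t).
Proof.
by apply: BOp_eq => v; rewrite /= lmulDl op_plus.
Qed.

Lemma Brmul_Brmul X s t : Brmul (Brmul X s) t = Brmul X (mult s t).
Proof. by apply: BOp_eq => v; rewrite /= lmulA. Qed.

Lemma Brmul_qreal X (r : R) : Brmul X (qreal r) = scal r X.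
Proof. by apply: BOp_eq => v; rewrite /= lmul_real op_scal. Qed.

Lemma Brmul_plus_l X Y s : Brmul (plus X Y) s = plus (Brmul X s) (Brmul Y s).
Proof. exact: BOp_eq. Qed.

Lemma Brmul_minus_l X Y s : Brmul (minus X Y) s = minus (Brmul X s) (Brmul Y s).
Proof. exact: BOp_eq. Qed.

Lemma Brmul_mult X Y s : Brmul (mult X Y) s = mult X (Brmul Y s).
Proof. exact: BOp_eq. Qed.

Lemma Blmul_mult X Y s : mult (Blmul s X) Y = Blmul s (mult X Y).
Proof. exact: BOp_eq. Qed.

Lemma Blmul_one s : Blmul s (one : BOp V) = Brmul one s.
Proof. exact: BOp_eq. Qed.

Lemma Blmul_plus_l X s t : Blmul (plus s t) X = plus (Blmul s X) (Blmul t X).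
Proof. by apply: BOp_eq => v; rewrite /= lmulDl. Qed.

Lemma Blmul_Blmul X s t : Blmul s (Blmul t X) = Blmul (mult s t) X.
Proof. by apply: BOp_eq => v; rewrite /= lmulA. Qed.

Lemma Blmul_qreal X (r : R) : Blmul (qreal r) X = scal r X.
Proof. by apply: BOp_eq => v; rewrite /= lmul_real. Qed.

Lemma Blmul_minus_r X Y s : Blmul s (minus X Y) = minus (Blmul s X) (Blmul s Y).
Proof.
rewrite /minus; apply: BOp_eq => v.
change (lmul s (plus (X v) (scal (-1) (Y v))) = plus (lmul s (X v)) (scal (-1) (lmul s (Y v)))).
by rewrite lmulDr -!rmul_real lrmulA.
Qed.

Definition BOp_complex_banach : complex_banach.
Proof.
refine (@Build_complex_banach (BOp_CompleteNormedModule V)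
  (fun z X => Brmul X (embed I z)) _ _ _ _ _).
- by move=> z X Y; exact: Brmul_plus_l.
- by move=> z w X; rewrite embed_plus // Brmul_plus_r.
- by move=> z w X; rewrite Brmul_Brmul -embed_mult // Cmult_comm.
- by move=> r X; rewrite embed_real // Brmul_qreal.
- by move=> z X; rewrite -(norm_embed I hI); exact: Bnorm_Brmul.
Defined.

Definition quat_complex_banach : complex_banach.
Proof.
refine (@Build_complex_banach quat_CompleteNormedModule
  (fun z q => mult q (embed I z)) _ _ _ _ _).
- by move=> z X Y; exact: mult_distr_r.
- by move=> z w X; rewrite embed_plus // mult_distr_l.
- by move=> z w X; rewrite -mult_assoc -embed_mult // Cmult_comm.
- move=> r [[[a b] c] d]; rewrite embed_real //; by apply: quat_eq; cbn; ring.
- move=> z X; rewrite -(norm_embed I hI).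
  move: X (embed I z) => [[[a b] c] d] [[[a' b'] c'] d']; right.
  rewrite /mult /= !quat_normE -sqrt_mult; [f_equal; ring|nra|nra].
Defined.

Local Notation E := BOp_complex_banach.
Add Ring sqz_ring : (sqz_ring_theory E).

Variable T : BOp V.

Definition slice_resolvent_set (z : C) : Prop := invertible (Q_op T (embed I z)).

Lemma Q_op_qconj s : Q_op T (qconj s) = Q_op T s.
Proof. by rewrite /Q_op qre_qconj norm_qconj. Qed.

Lemma op_inv_inverse X : invertible X -> is_inverse X (op_inv X).
Proof. exact: epsilon_spec. Qed.

Lemma Q_op_mult s X :
  mult (Q_op T s) X =
  plus (minus (mult T (mult T X)) (scal (2 * qre s) (mult T X))) (scal (norm s ^ 2) X).
Proof. exact: BOp_eq. Qed.

Lemma op_inv_commute X Y : invertible X -> mult X Y = mult Y X ->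
  mult (op_inv X) Y = mult Y (op_inv X).
Proof.
move=> /op_inv_inverse [h1 h2] h.
by rewrite -{1}(mult_one_r Y) -h1 (mult_assoc Y) -h -mult_assoc (mult_assoc _ X) h2 mult_one_l.
Qed.

Lemma Q_op_commute s : mult (Q_op T s) T = mult T (Q_op T s).
Proof.
rewrite Q_op_mult /Q_op mult_distr_l mult_minus_r !mult_Bscal mult_one_r.
by rewrite -?mult_assoc.
Qed.

Definition qresolvent s X : BOp V :=
  mult (op_inv (Q_op T s)) (minus (Brmul X (qconj s)) (mult T X)).

(* [Q_s = (R_s - T) (R_conj(s) - T)] where [R_s] is right multiplication by [s]. *)
Lemma Q_op_factor s X :
  let Y := minus (Brmul X (qconj s)) (mult T X) in
  minus (Brmul Y s) (mult T Y) = mult (Q_op T s) X.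
Proof.
move=> Y; rewrite /Y Q_op_mult Brmul_minus_l mult_minus_r Brmul_Brmul mult_qconj_l Brmul_qreal.
have : plus (Brmul (mult T X) s) (mult T (Brmul X (qconj s))) = scal (2 * qre s) (mult T X).
{ by rewrite -Brmul_mult -Brmul_plus_r plus_qconj Brmul_qreal. }
set a := Brmul (mult T X) s; set b := mult T (Brmul X _); set c := mult T (mult T X).
set d := scal _ X; move=> <-.
change (minus (minus d a) (minus b c) = plus (minus c (plus a b)) d :> E).
cmodule.
Qed.

Lemma qresolvent_right s X : invertible (Q_op T s) ->
  minus (Brmul (qresolvent s X) s) (mult T (qresolvent s X)) = X.
Proof.
move=> h; have c := op_inv_commute _ T h (Q_op_commute s).
rewrite /qresolvent Brmul_mult mult_assoc -c -mult_assoc -mult_minus_r Q_op_factor.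
by rewrite mult_assoc (proj2 (op_inv_inverse _ h)) mult_one_l.
Qed.

Lemma qresolvent_left s X : invertible (Q_op T s) ->
  qresolvent s (minus (Brmul X s) (mult T X)) = X.
Proof.
move=> h; rewrite /qresolvent.
have := Q_op_factor (qconj s) X; rewrite qconj_conj Q_op_qconj => /= ->.
by rewrite mult_assoc (proj2 (op_inv_inverse _ h)) mult_one_l.
Qed.

Lemma SL_inv_qresolvent s : SL_inv s T = qresolvent s one.
Proof.
by rewrite /SL_inv /qresolvent opp_mult_r opp_minus mult_one_r Blmul_one.
Qed.

Lemma SL_inv_equation s : invertible (Q_op T s) ->
  minus (Brmul (SL_inv s T) s) (mult T (SL_inv s T)) = one.
Proof. rewrite SL_inv_qresolvent; exact: qresolvent_right. Qed.

Lemma SR_inv_equation s : invertible (Q_op T s) ->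
  minus (Blmul s (SR_inv s T)) (mult (SR_inv s T) T) = one.
Proof.
move=> h; have c := op_inv_commute _ T h (Q_op_commute s).
have e : SR_inv s T = minus (Blmul (qconj s) (op_inv (Q_op T s))) (mult T (op_inv (Q_op T s))).
{ by rewrite /SR_inv opp_mult_l opp_minus mult_minus_l Blmul_mult mult_one_l. }
rewrite e; set q := op_inv _ in c *.
have -> : mult (minus (Blmul (qconj s) q) (mult T q)) T =
  minus (Blmul (qconj s) (mult T q)) (mult T (mult T q)).
{ by rewrite mult_minus_l Blmul_mult -mult_assoc c. }
rewrite Blmul_minus_r Blmul_Blmul mult_qconj_r Blmul_qreal.
have := Q_op_mult s q; rewrite (proj1 (op_inv_inverse _ h)) => ->.
have : plus (Blmul s (mult T q)) (Blmul (qconj s) (mult T q)) = scal (2 * qre s) (mult T q).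
{ by rewrite -Blmul_plus_l plus_qconj Blmul_qreal. }
set a := Blmul s _; set b := Blmul _ _; set d := scal _ q; set k := mult T (mult T q) => <-.
change (minus (minus d a) (minus b k) = plus (minus k (plus a b)) d :> E).
cmodule.
Qed.

End Operator_resolvent.

Lemma is_linear_Brmul (V : TwoSidedBanach) (X : BOp V) :
  is_linear (U := quat_NormedModule) (V := BOp_NormedModule V) (fun s => Brmul X s).
Proof.
split.
- exact: Brmul_plus_r.
- move=> r s; change (Brmul X (scal r s) = scal r (Brmul X s)).
  have -> : scal r s = mult (qreal r) s.
  { move: s => [[[a b] c] d]; by apply: quat_eq; cbn; ring. }
  apply: BOp_eq => v; by rewrite /= -lmulA lmul_real op_scal.
- exists (norm X + 1); split; first by have := Bnorm_ge0 X; rewrite /norm /=; lra.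
  move=> s; apply: Rle_trans (Bnorm_Brmul _ X s) _; rewrite Rmult_comm.
  apply: Rmult_le_compat_r; [exact: (norm_ge_0 (V := quat_NormedModule))|lra].
Qed.

Lemma is_linear_qconj : is_linear (U := quat_NormedModule) (V := quat_NormedModule) qconj.
Proof.
split.
- by move=> [[[a b] c] d] [[[a' b'] c'] d']; apply: quat_eq; cbn; ring.
- by move=> r [[[a b] c] d]; apply: quat_eq; cbn; ring.
- by exists 1; split; [lra|move=> s; rewrite norm_qconj; lra].
Qed.

Section Slice_cycles.
Variable I : quat.
Hypothesis hI : imag_unit I.

(* [ds_I / (2 PI)] for the velocity [v]. *)
Definition dsI (v : quat) : quat := scal (/ (2 * PI)) (mult (opp v) I).

Definition slice_cycle (G : list (jordan_curve I)) : cycle :=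
  map (fun g => (fun t => coord I (path g t), fun t => coord I (dsI (velocity g t)))) G.

Lemma is_linear_mult_I : is_linear (U := quat_NormedModule) (V := quat_NormedModule)
  (fun s => mult s I).
Proof.
have := is_linear_cscal (quat_complex_banach I hI) Ci.
by rewrite /cscal /= embed_Ci.
Qed.

Lemma is_linear_dsI : is_linear (U := quat_NormedModule) (V := quat_NormedModule) dsI.
Proof.
apply: (is_linear_comp (U := quat_NormedModule) (V := quat_NormedModule)
  (W := quat_NormedModule) (fun v => mult (opp v) I) (fun s => scal (/ (2 * PI)) s)).
{ apply: (is_linear_comp (U := quat_NormedModule) (V := quat_NormedModule)
    (W := quat_NormedModule) opp (fun s => mult s I)).
  - exact: is_linear_opp.
  - exact: is_linear_mult_I. }
by apply: is_linear_scal_r => n m; exact: Rmult_comm.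
Qed.

Lemma dsI_slice v : slice I v -> slice I (dsI v).
Proof.
move=> /(embed_coord I hI) <-; move: (coord I v) => [x y].
case: (imag_unit_coord I hI) => i [j [k [e n]]].
exists (/ (2 * PI) * y), (- / (2 * PI) * x).
rewrite -[slice_point I _ _]/(embed I (_, _)) /dsI !(embedE I i j k e) e /=.
apply: quat_eq; cbn; try ring.
transitivity (/ (2 * PI) * y * (i ^ 2 + j ^ 2 + k ^ 2)); [|rewrite n]; ring.
Qed.

Lemma regular_slice_cycle (G : list (jordan_curve I)) : regular_cycle (slice_cycle G).
Proof.
move=> _ /in_map_iff [g [<- hg]] t ht /=; split.
- apply: (continuous_comp (V := quat_UniformSpace) (path g) (coord I)).
  + apply: (ex_derive_continuous (V := quat_NormedModule)).
    exists (velocity g t); exact: path_derive.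
  + exact: (linear_cont _ _ (is_linear_coord I hI)).
- apply: (continuous_comp (V := quat_UniformSpace) (velocity g) (fun v => coord I (dsI v))).
  + exact: velocity_continuous.
  + apply: (linear_cont (U := quat_NormedModule) (V := C_R_NormedModule)).
    apply: is_linear_comp; [exact: is_linear_dsI|exact: is_linear_coord].
Qed.

Lemma on_slice_cycle (G : list (jordan_curve I)) z :
  on_cycle (slice_cycle G) z <-> on_curves G (embed I z).
Proof.
split.
- move=> [_ [/in_map_iff [g [<- hg]] [t [ht /= <-]]]].
  exists g; split=> //; exists t; split=> //; rewrite embed_coord //; exact: path_slice.
- move=> [g [hg [t [ht e]]]].
  eexists; split; first by apply/in_map_iff; exists g; split; [reflexivity|].
  exists t; split=> //=; by rewrite e coord_embed.
Qed.

Lemma contour_integral_cycle (F : complex_banach) (G : list (jordan_curve I))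
    (W : quat -> quat -> F) (w : C -> F) :
  continuous_on_cycle (slice_cycle G) w ->
  (forall s d, slice I s -> slice I d ->
     scal (/ (2 * PI)) (W s d) = cscal (coord I (scal (/ (2 * PI)) d)) (w (coord I s))) ->
  scal (/ (2 * PI)) (contour_integral G W) = cycle_integral (slice_cycle G) w.
Proof.
move=> hw h.
have pi0 := PI_RGT_0.
have e u : scal (/ (2 * PI)) (scal (2 * PI) u) = u :> F.
{ rewrite -!cscal_real cscal_mult -RtoC_mult Rinv_l; last lra.
  exact: cscal_1. }
have e' u : scal (2 * PI) (scal (/ (2 * PI)) u) = u :> F.
{ rewrite -!cscal_real cscal_mult -RtoC_mult Rinv_r; last lra.
  exact: cscal_1. }
rewrite -[RHS]e; f_equal.
rewrite /cycle_integral.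
rewrite -(sum_RInt_linear _ F F (fun u => scal (2 * PI) u)); last first.
{ move=> g hg; exact: (ex_RInt_integrand _ _ _ _ (regular_slice_cycle G) hw hg). }
{ by apply: is_linear_scal_r => n m; exact: Rmult_comm. }
rewrite /sum_RInt map_map.
apply: (sum_RInt_ext _ F (fun g t => W (path g t) (mult (opp (velocity g t)) I))) => g hg t ht.
have ht' : 0 <= t <= 1 by lra.
rewrite /= -[LHS]e'; f_equal.
apply: h; first exact: path_slice.
have -> : mult (opp (velocity g t)) I = scal (2 * PI) (dsI (velocity g t)).
{ rewrite /dsI; move: (mult (opp (velocity g t)) I) => [[[a b] c] d].
  by apply: quat_eq; cbn; field; lra. }
apply: slice_scal; apply: dsI_slice; rewrite -(velocity_slice I hI g t ht); exact: slice_embed.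
Qed.

Lemma qinv_embed z : qinv (embed I z) = embed I (/ z)%C.
Proof.
rewrite /qinv norm_embed // -embed_conj // Cmod_sqr.
case: (imag_unit_coord I hI) => i [j [k [e n]]]; rewrite !(embedE I i j k e).
by apply: quat_eq; cbn; rewrite /Rdiv; ring.
Qed.

Lemma winding_cycle (G : list (jordan_curve I)) z : ~ on_cycle (slice_cycle G) z ->
  winding G (embed I z) =
  cycle_integral (E := quat_complex_banach I hI) (slice_cycle G)
    (fun s => @cscal (quat_complex_banach I hI) (/ (s - z))%C (one : quat)).
Proof.
move=> off; apply: (contour_integral_cycle (quat_complex_banach I hI)).
- apply: continuous_on_cycle_cauchy_kernel => // s hs; exact: continuous_const.
- move=> s d hs hd.
  change (scal (/ (2 * PI)) (mult d (qinv (minus s (embed I z)))) =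
    mult (mult one (embed I (/ (coord I s - z))%C)) (embed I (coord I (scal (/ (2 * PI)) d)))).
  rewrite mult_one_l.
  rewrite -{1}(embed_coord I hI s hs).
  rewrite -embed_minus //.
  rewrite qinv_embed embed_coord //; last first.
  { exact: slice_scal. }
  rewrite -[d](embed_coord I hI d hd).
  case: (imag_unit_coord I hI) => i [j [k [e n]]]; rewrite !(embedE I i j k e).
  by apply: quat_eq; cbn; ring.
Qed.

Lemma sum_velocity (G : list (jordan_curve I)) :
  sum_RInt (V := quat_CompleteNormedModule) (fun g t => velocity g t) G = zero.
Proof.
rewrite /sum_RInt; elim: G => [|g G IH] //=; rewrite IH plus_zero_r.
have -> : RInt (V := quat_CompleteNormedModule) (fun t => velocity g t) 0 1 =
  minus (path g 1) (path g 0).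
{ apply: is_RInt_unique; apply: (is_RInt_derive (V := quat_CompleteNormedModule) (path g)) => t;
    rewrite Rmin_left ?Rmax_right; try lra; move=> ht.
  - exact: path_derive.
  - exact: velocity_continuous. }
by rewrite -path_closed minus_eq_zero.
Qed.

(* The conjugate cycle without reversal of its orientation: [- conj kappa] is the
   weight [ds_I / (2 PI)] of the conjugate curve. *)
Definition conj_cycle (G : cycle) : cycle :=
  map (fun g => (fun t => Cconj (fst g t), fun t => (- Cconj (snd g t))%C)) G.

Lemma continuous_conj z : continuous (T := C_UniformSpace) (U := C_UniformSpace) Cconj z.
Proof.
apply: (lipschitz_continuous C_R_NormedModule _ z 1).
apply: filter_forall => w; rewrite -Cmod_norm Rmult_1_l -(Cmod_conj (w - z)) Cminus_conj.
exact: Rle_refl.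
Qed.

Lemma continuous_Copp z : continuous (T := C_UniformSpace) (U := C_UniformSpace) Copp z.
Proof.
apply: (lipschitz_continuous C_R_NormedModule _ z 1).
apply: filter_forall => w; rewrite -Cmod_norm Rmult_1_l -(Cmod_opp (w - z)).
right; f_equal; change (- w - - z = - (w - z))%C; ring.
Qed.

Lemma regular_conj_cycle (G : cycle) : regular_cycle G -> regular_cycle (conj_cycle G).
Proof.
move=> hG _ /in_map_iff [g [<- hg]] t ht /=; case: (hG g hg t ht) => h1 h2; split.
- apply: (continuous_comp (V := C_UniformSpace) (fst g) Cconj) => //; exact: continuous_conj.
- apply: (continuous_comp (V := C_UniformSpace) (fun t => Cconj (snd g t)) Copp);
    last exact: continuous_Copp.
  apply: (continuous_comp (V := C_UniformSpace) (snd g) Cconj) => //; exact: continuous_conj.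
Qed.

Lemma on_conj_cycle (G : cycle) z : on_cycle (conj_cycle G) z -> on_cycle G (Cconj z).
Proof.
move=> [_ [/in_map_iff [g [<- hg]] [t [ht /= <-]]]]; rewrite Cconj_conj.
by exists g; split=> //; exists t.
Qed.

End Slice_cycles.

(** * The theorem *)

Section Riesz.
Variables (V : TwoSidedBanach) (T : BOp V) (I : quat).
Hypothesis hI : imag_unit I.

Local Notation E := (BOp_complex_banach V I hI).
Add Ring sqz_ring : (sqz_ring_theory E).

Local Notation rho := (slice_resolvent_set V I T).
Let Rs (z : C) : E -> E := fun X => qresolvent V T (embed I z) X.
Let M : E -> E := fun X => mult T X.

Lemma clinear_Bmult_l (X : BOp V) : clinear (E := E) (fun Y => mult X Y).
Proof. by split; [exact: is_linear_Bmult_l|move=> z Y; rewrite /cscal /= Brmul_mult]. Qed.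

Lemma slice_resolvent_set_open : open (T := C_UniformSpace) rho.
Proof.
suff main (z0 : C) : rho z0 -> locally (T := C_UniformSpace) z0 rho by exact: main.
move=> h0; set S := op_inv (Q_op T (embed I z0)).
pose K := 2 * Bnorm T + 2 * Cmod z0 + 1.
have T0 := Bnorm_ge0 T; have S0 := Bnorm_ge0 S; have z00 := Cmod_ge_0 z0.
have K0 : 0 < K by rewrite /K; lra.
have SK : 0 <= Bnorm S * K by apply: Rmult_le_pos; [exact: S0|lra].
have d0 : 0 < Rmin 1 (/ (Bnorm S * K + 1)).
{ apply: Rmin_pos; first lra; apply: Rinv_0_lt_compat; lra. }
apply: filter_imp (cscal_sub_near z0 _ d0) => z hz.
have h1 := Rlt_le_trans _ _ _ hz (Rmin_l _ _).
have h2 := Rlt_le_trans _ _ _ hz (Rmin_r _ _).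
apply: (invertible_near _ _ _ _ (op_inv_inverse _ _ h0)); rewrite -/S.
set d := Cmod (z - z0) in h1 h2.
have d00 : 0 <= d by exact: Cmod_ge_0.
have e : minus (Q_op T (embed I z0)) (Q_op T (embed I z)) =
  plus (scal (2 * (fst z - fst z0)) T) (scal (Cmod z0 ^ 2 - Cmod z ^ 2) (one : BOp V)).
{ rewrite /Q_op !norm_embed //.
  have re w : qre (embed I w) = fst w.
  { by case: (imag_unit_coord I hI) => i [j [k [e n]]]; rewrite (embedE I i j k e). }
  rewrite !re; set a := mult T T; set b := (one : BOp V).
  change (minus (plus (minus a (scal (2 * fst z0) T)) (scal (Cmod z0 ^ 2) b))
    (plus (minus a (scal (2 * fst z) T)) (scal (Cmod z ^ 2) b)) =
    plus (scal (2 * (fst z - fst z0)) T) (scal (Cmod z0 ^ 2 - Cmod z ^ 2) b) :> E).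
  rewrite -!(cscal_real E) !RtoC_minus !RtoC_mult !RtoC_minus; cmodule. }
have bound : norm (minus (Q_op T (embed I z0)) (Q_op T (embed I z))) <= d * K.
{ rewrite e; apply: Rle_trans (Bnorm_triangle _ _) _.
  apply: Rle_trans (Rplus_le_compat _ _ _ _ (Bnorm_scal _ _) (Bnorm_scal _ _)) _.
  have o1 : Bnorm (one : BOp V) <= 1.
  { apply: Bnorm_le => [|v]; first lra; rewrite Rmult_1_l; exact: Rle_refl. }
  have i1 : Rabs (2 * (fst z - fst z0)) <= 2 * d.
  { rewrite Rabs_mult (Rabs_pos_eq 2); last lra.
    apply: Rmult_le_compat_l; first lra.
    exact: (re_le_Cmod (z - z0)). }
  have i2 : Rabs (Cmod z0 ^ 2 - Cmod z ^ 2) <= d * (2 * Cmod z0 + 1).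
  { have j1 : Cmod z <= Cmod z0 + d by exact: Cmod_sub_le.
    have j2 : Cmod z0 <= Cmod z + d.
    { have -> : d = Cmod (z0 - z) by rewrite /d -Cmod_opp; f_equal; ring.
      exact: Cmod_sub_le. }
    have := Cmod_ge_0 z => z1; apply: Rabs_le; nra. }
  have o0 := Bnorm_ge0 (one : BOp V).
  have p1 : Rabs (2 * (fst z - fst z0)) * Bnorm T <= 2 * d * Bnorm T by apply: Rmult_le_compat_r.
  have p2 : Rabs (Cmod z0 ^ 2 - Cmod z ^ 2) * Bnorm (one : BOp V) <= d * (2 * Cmod z0 + 1) * 1.
  { apply: Rmult_le_compat => //; exact: Rabs_pos. }
  rewrite /K; lra. }
apply: Rle_lt_trans (Rmult_le_compat_l _ _ _ S0 bound) _.
have sk1 : 0 < Bnorm S * K + 1 by lra.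
have := Rmult_lt_compat_r _ _ _ sk1 h2; rewrite Rinv_l; last lra.
nra.
Qed.

Lemma slice_resolvent_set_inhabited : exists z, rho z.
Proof.
have T0 := Bnorm_ge0 T.
pose x := 3 * Bnorm T + 1.
have x1 : 0 < x by rewrite /x; lra.
exists (RtoC x); rewrite /slice_resolvent_set embed_real //.
apply: (invertible_near _ (scal (x ^ 2) (one : BOp V)) _ (scal (/ x ^ 2) (one : BOp V))).
{ split; rewrite -Bscal_mult mult_one_l.
  - rewrite -[RHS](scal_one (K := R_Ring) (V := BOp_ModuleSpace V)) scal_assoc.
    by f_equal; apply: Rinv_r; nra.
  - rewrite -[RHS](scal_one (K := R_Ring) (V := BOp_ModuleSpace V)) scal_assoc.
    by f_equal; apply: Rinv_l; nra. }
have e : minus (scal (x ^ 2) (one : BOp V)) (Q_op T (qreal x)) =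
  plus (scal (2 * x) T) (scal (-1) (mult T T)).
{ rewrite /Q_op.
  have -> : norm (qreal x) ^ 2 = x ^ 2 by rewrite quat_norm_sqr; ring.
  rewrite [qre _]/=; set a := mult T T; set b := (one : BOp V).
  change (minus (scal (x ^ 2) b) (plus (minus a (scal (2 * x) T)) (scal (x ^ 2) b)) =
    plus (scal (2 * x) T) (scal (-1) a) :> E).
  have -> : scal (-1) a = opp a :> E.
  { exact: (scal_opp_one (K := R_Ring) (V := BOp_ModuleSpace V)). }
  cmodule. }
have b1 : Bnorm (minus (scal (x ^ 2) (one : BOp V)) (Q_op T (qreal x))) <=
  2 * x * Bnorm T + Bnorm T * Bnorm T.
{ rewrite e; apply: Rle_trans (Bnorm_triangle _ _) _.
  apply: Rle_trans (Rplus_le_compat _ _ _ _ (Bnorm_scal _ _) (Bnorm_scal _ _)) _.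
  rewrite Rabs_Ropp Rabs_R1 Rmult_1_l Rabs_pos_eq; last lra.
  apply: Rplus_le_compat_l; exact: Bnorm_mult. }
have b2 : Bnorm (scal (/ x ^ 2) (one : BOp V)) <= / x ^ 2.
{ apply: Rle_trans (Bnorm_scal _ _) _.
  have i0 : 0 < / x ^ 2 by apply: Rinv_0_lt_compat; nra.
  rewrite Rabs_pos_eq; last lra.
  rewrite -{2}(Rmult_1_r (/ x ^ 2)); apply: Rmult_le_compat_l; first lra.
  apply: Bnorm_le => [|v]; first lra; rewrite Rmult_1_l; exact: Rle_refl. }
apply: Rle_lt_trans (Rmult_le_compat _ _ _ _ (Bnorm_ge0 _) (Bnorm_ge0 _) b2 b1) _.
apply: (Rmult_lt_reg_l (x ^ 2)); first nra.
rewrite -Rmult_assoc Rinv_r; last nra.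
rewrite /x; nra.
Qed.

Lemma RsE z : Rs z = fun X =>
  mult (op_inv (Q_op T (embed I z))) (minus (cscal (Cconj z) X) (M X)).
Proof. by rewrite /Rs /qresolvent /cscal /= embed_conj. Qed.

Lemma clinear_Rs z : clinear (Rs z).
Proof.
have h := clinear_sub _ _ _ (clinear_cscal E (Cconj z)) (clinear_Bmult_l T).
have h' := clinear_comp E _ _ (clinear_Bmult_l (op_inv (Q_op T (embed I z)))) h.
rewrite RsE. exact h'.
Qed.

Lemma Rs_right z X : rho z -> minus (cscal z (Rs z X)) (M (Rs z X)) = X.
Proof. move=> h; exact (qresolvent_right V I hI T (embed I z) X h). Qed.

Lemma Rs_left z X : rho z -> Rs z (minus (cscal z X) (M X)) = X.
Proof. move=> h; exact (qresolvent_left V I hI T (embed I z) X h). Qed.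

Lemma clinear_M : clinear M.
Proof. exact: clinear_Bmult_l. Qed.

Lemma locally_embed (W : quat -> Prop) z : open W -> W (embed I z) ->
  locally (T := C_UniformSpace) z (fun w => W (embed I w)).
Proof.
move=> hW hz.
have hc : continuous (T := C_UniformSpace) (U := quat_UniformSpace) (embed I) z.
{ apply: (lipschitz_continuous quat_NormedModule _ z 1).
  apply: filter_forall => w; rewrite -embed_minus // norm_embed // Rmult_1_l.
  exact: Rle_refl. }
exact: hc (hW _ hz).
Qed.

Lemma closure_of (A : quat -> Prop) s : A s -> closure A s.
Proof. by move=> hs N /locally_singleton hN; exists s. Qed.

Lemma closure_incl (A B : quat -> Prop) s : (forall t, A t -> B t) -> closure A s -> closure B s.
Proof. by move=> h hA N /hA [t [hN ht]]; exists t; split=> //; apply: h. Qed.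

Lemma axial_conj (W : quat -> Prop) z :
  axially_symmetric W -> W (embed I z) -> W (embed I (Cconj z)).
Proof.
move=> hW hz; case: (imag_unit_coord I hI) => i [j [k [e n]]].
have hJ : imag_unit (opp I).
{ rewrite e; split; [cbn; ring|].
  transitivity (norm (V := quat_NormedModule) (opp I)); first by rewrite e.
  rewrite norm_opp; exact: (proj2 hI). }
have := hW _ _ _ _ hI hJ hz.
have -> // : slice_point (opp I) (fst z) (snd z) = embed I (Cconj z).
rewrite (embedE I i j k e) /slice_point e; by apply: quat_eq; cbn; ring.
Qed.

Variables (U1 U2 : quat -> Prop) (G : list (jordan_curve I)).
Hypothesis hspec : forall s, S_spectrum T s -> U1 s \/ U2 s.
Hypothesis hopen1 : open U1.
Hypothesis hopen2 : open U2.
Hypothesis haxial1 : axially_symmetric U1.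
Hypothesis haxial2 : axially_symmetric U2.
Hypothesis hdisj : forall s, ~ (closure U1 s /\ closure U2 s).
Hypothesis hG : positive_boundary U1 G.

Let U (z : C) : Prop := U1 (embed I z) \/ U2 (embed I z).
Local Notation Gamma := (slice_cycle I G).

Lemma U_open : open (T := C_UniformSpace) U.
Proof.
move=> z [h|h].
- by apply: filter_imp (locally_embed _ _ hopen1 h) => w; left.
- by apply: filter_imp (locally_embed _ _ hopen2 h) => w; right.
Qed.

Lemma rho_or_U z : rho z \/ U z.
Proof.
case: (classic (rho z)) => h; first by left.
by right; apply: hspec.
Qed.

Lemma U1_not_U2 s : U1 s -> ~ U2 s.
Proof. by move=> h1 h2; apply: (hdisj s); split; apply: closure_of. Qed.

Lemma U_off z : U z -> ~ on_cycle Gamma z.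
Proof.
move=> hz /(on_slice_cycle I hI) /(proj1 hG) [_ [hin hout]].
case: hz => h.
- by case: (hout U1 (hopen1 _ h)) => t [h1 [_ h2]].
- apply: (hdisj (embed I z)); split; last exact: closure_of.
  by apply: closure_incl hin => t [].
Qed.

Lemma Gamma_rho z : on_cycle Gamma z -> rho z.
Proof. by move=> h; case: (rho_or_U z) => // /U_off. Qed.

Lemma U_conj z : U z -> U (Cconj z).
Proof. by case=> h; [left|right]; apply: axial_conj. Qed.

Definition index (z : C) : C :=
  match excluded_middle_informative (U1 (embed I z)) with left _ => 1 | right _ => 0 end.

Lemma index_1 z : U1 (embed I z) -> index z = 1.
Proof. by rewrite /index; case: excluded_middle_informative. Qed.

Lemma index_0 z : U2 (embed I z) -> index z = 0.
Proof. by rewrite /index; case: excluded_middle_informative => // h /(U1_not_U2 _ h). Qed.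

Lemma index_conj z : U z -> index (Cconj z) = index z.
Proof.
by case=> h; [rewrite !index_1|rewrite !index_0] => //; apply: axial_conj.
Qed.

Lemma winding_index z : U z -> winding G (embed I z) = embed I (index z).
Proof.
case=> h.
- rewrite index_1 // embed_real //; apply: (proj1 (proj2 hG)) => //; exact: slice_embed.
- rewrite index_0 // embed_real //; apply: (proj2 (proj2 hG)); first exact: slice_embed.
  move=> hc; apply: (hdisj (embed I z)); split; last exact: closure_of.
  by apply: closure_incl hc => t [].
Qed.

Lemma kernel_continuous z : ~ on_cycle Gamma z -> continuous_on_cycle Gamma
  (fun s => @cscal (quat_complex_banach I hI) (/ (s - z))%C (one : quat)).
Proof.
move=> off; apply: continuous_on_cycle_cauchy_kernel => // s hs; exact: continuous_const.
Qed.

Lemma winding_Gamma z u : U z ->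
  cycle_integral Gamma (fun s => cscal (/ (s - z)) u) = cscal (index z) u :> E.
Proof.
move=> hz; have off := U_off z hz.
rewrite -[cscal (index z) u]/(Brmul u (embed I (index z))) -winding_index // winding_cycle //.
rewrite /cycle_integral.
rewrite -(sum_RInt_linear _ quat_CompleteNormedModule (BOp_CompleteNormedModule V)
  (fun s => Brmul u s)); last first.
{ move=> g hg.
  exact (ex_RInt_integrand _ _ _ _ (regular_slice_cycle I hI G)
    (kernel_continuous z off) hg). }
{ exact: is_linear_Brmul. }
apply: sum_RInt_ext => g hg t ht.
change (Brmul (Brmul u (embed I (/ (fst g t - z))%C)) (embed I (snd g t)) =
  Brmul u (mult (mult one (embed I (/ (fst g t - z))%C)) (embed I (snd g t)))).
by rewrite mult_one_l Brmul_Brmul.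
Qed.

Lemma winding_conj_Gamma z u : U z ->
  cycle_integral (conj_cycle Gamma) (fun s => cscal (/ (s - z)) u) =
  opp (cscal (index z) u) :> E.
Proof.
move=> hz; have hz' := U_conj z hz; have off := U_off _ hz'.
have -> : opp (cscal (index z) u) = opp (Brmul u (qconj (embed I (index (Cconj z))))) :> E.
{ rewrite index_conj // -embed_conj //.
  have -> // : Cconj (index z) = index z.
  by rewrite /index; case: excluded_middle_informative => _;
    apply: injective_projections => /=; ring. }
rewrite -winding_index // winding_cycle //.
rewrite /cycle_integral.
rewrite -(sum_RInt_linear _ quat_CompleteNormedModule (BOp_CompleteNormedModule V)
  (fun s => opp (Brmul u (qconj s)))); last first.
{ move=> g hg.
  exact (ex_RInt_integrand _ _ _ _ (regular_slice_cycle I hI G)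
    (kernel_continuous _ off) hg). }
{ apply: (is_linear_comp (U := quat_NormedModule) (V := BOp_NormedModule V)
    (W := BOp_NormedModule V) (fun s => Brmul u (qconj s)) opp); last exact: is_linear_opp.
  apply: (is_linear_comp (U := quat_NormedModule) (V := quat_NormedModule)
    (W := BOp_NormedModule V) qconj (fun s => Brmul u s)).
  - exact: is_linear_qconj.
  - exact: is_linear_Brmul. }
rewrite /sum_RInt map_map.
apply: (sum_RInt_ext _ E) => g hg t ht.
change (Brmul (Brmul u (embed I (/ (Cconj (fst g t) - z))%C)) (embed I (- Cconj (snd g t))%C) =
  opp (Brmul u (qconj (mult (mult one (embed I (/ (fst g t - Cconj z))%C)) (embed I (snd g t)))))).
have ne : (fst g t - Cconj z)%C <> 0.
{ move=> e; apply: off; exists g; split=> //; exists t; split; first lra.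
  by rewrite -(Cplus_0_l (Cconj z)) -e; ring. }
rewrite mult_one_l Brmul_Brmul -!embed_mult // -embed_conj // Cmult_conj Cinv_conj //.
rewrite Cminus_conj Cconj_conj.
change (cscal (/ (Cconj (fst g t) - z) * - Cconj (snd g t))%C u =
  opp (cscal (/ (Cconj (fst g t) - z) * Cconj (snd g t))%C u) :> E).
cmodule.
Qed.

Local Notation p := (riesz_projector E Rs Gamma).

Lemma Rs_continuous X : continuous_on_cycle (E := E) Gamma (fun s => Rs s X).
Proof.
exact (continuous_resolvent E M rho Rs slice_resolvent_set_open (fun z _ => clinear_Rs z)
  Rs_right Rs_left Gamma Gamma_rho X).
Qed.

Lemma projector_idempotent X : p (p X) = p X.
Proof.
apply: (riesz_projector_idempotent E M rho Rs clinear_M slice_resolvent_set_open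
  (fun z _ => clinear_Rs z) Rs_right Rs_left Gamma (regular_slice_cycle I hI G) Gamma_rho
  U U_open rho_or_U U_off slice_resolvent_set_inhabited index).
- by move=> z; rewrite /index; case: excluded_middle_informative => _; [right|left].
- move=> z [h|h].
  + apply: filter_imp (locally_embed _ _ hopen1 h) => w hw; by rewrite !index_1.
  + apply: filter_imp (locally_embed _ _ hopen2 h) => w hw; by rewrite !index_0.
- exact: winding_Gamma.
Qed.

Lemma rho_conj z : rho (Cconj z) -> rho z.
Proof. by rewrite /slice_resolvent_set embed_conj // Q_op_qconj. Qed.

Lemma conj_Gamma_rho z : on_cycle (conj_cycle Gamma) z -> rho z.
Proof. by move=> /on_conj_cycle /Gamma_rho /rho_conj. Qed.

Lemma projector_conj X : plus (p X) (riesz_projector E Rs (conj_cycle Gamma) X) = zero.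
Proof.
rewrite /riesz_projector -cycle_integral_app.
have on_app z : on_cycle (Gamma ++ conj_cycle Gamma) z ->
  on_cycle Gamma z \/ on_cycle (conj_cycle Gamma) z.
{ by move=> [g [/in_app_iff [hg|hg] ht]]; [left|right]; exists g. }
apply: (riesz_projector_zero E M rho Rs clinear_M slice_resolvent_set_open
  (fun z _ => clinear_Rs z) Rs_right Rs_left (Gamma ++ conj_cycle Gamma) _ _
  U U_open rho_or_U _ slice_resolvent_set_inhabited).
- move=> g /in_app_iff [hg|hg].
  + exact: (regular_slice_cycle I hI G).
  + exact: (regular_conj_cycle _ (regular_slice_cycle I hI G)).
- move=> s /on_app [|]; [exact: Gamma_rho|exact: conj_Gamma_rho].
- move=> z hz /on_app [|/on_conj_cycle]; first exact: U_off.
  exact: U_off (U_conj _ hz).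
- move=> z u hz; rewrite cycle_integral_app winding_Gamma // winding_conj_Gamma //.
  exact: plus_opp_r.
Qed.

Lemma RtoC_2Re (z : C) : RtoC (2 * Re z) = (z + Cconj z)%C.
Proof. by case: z => x y; apply: injective_projections; rewrite /=; ring. Qed.

(* Conjugate points contribute with real coefficients. *)
Lemma Rs_pair k z X :
  plus (cscal k (Rs z X)) (cscal (- (1))%C (cscal (- Cconj k)%C (Rs (Cconj z) X))) =
  mult (op_inv (Q_op T (embed I z)))
    (minus (scal (2 * Re (k * Cconj z)) X) (scal (2 * Re k) (mult T X))) :> E.
Proof.
rewrite !RsE Cconj_conj embed_conj // Q_op_qconj; set q := op_inv _.
have hq := clinear_Bmult_l q.
rewrite -!(proj2 hq) -(clinear_plus _ _ _ hq); congr mult.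
rewrite -!(cscal_real E) !RtoC_2Re Cmult_conj Cconj_conj -/(M X).
change (plus (cscal k (minus (cscal (Cconj z) X) (M X)))
  (cscal (- (1))%C (cscal (- Cconj k)%C (minus (cscal z X) (M X)))) =
  minus (cscal (k * Cconj z + Cconj k * z)%C X) (cscal (k + Cconj k)%C (M X)) :> E).
cmodule.
Qed.

Lemma projector_mult X : p X = mult (p one) X.
Proof.
pose h (Y : E) (g : (R -> C) * (R -> C)) t : E :=
  plus (cscal (snd g t) (Rs (fst g t) Y))
    (cscal (- (1))%C (cscal (- Cconj (snd g t))%C (Rs (Cconj (fst g t)) Y))).
have e1 Y g : In g Gamma -> ex_RInt (V := E) (fun t => cscal (snd g t) (Rs (fst g t) Y)) 0 1.
{ move=> hg.
  exact (ex_RInt_integrand E _ _ _ (regular_slice_cycle I hI G) (Rs_continuous Y) hg). }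
have cc Y : continuous_on_cycle (E := E) (conj_cycle Gamma) (fun s => Rs s Y).
{ exact (continuous_resolvent E M rho Rs slice_resolvent_set_open (fun z _ => clinear_Rs z)
    Rs_right Rs_left _ conj_Gamma_rho Y). }
have e2 Y g : In g Gamma ->
  ex_RInt (V := E) (fun t => cscal (- Cconj (snd g t))%C (Rs (Cconj (fst g t)) Y)) 0 1.
{ move=> hg.
  exact (ex_RInt_integrand E _ _ _ (regular_conj_cycle _ (regular_slice_cycle I hI G)) (cc Y)
    (in_map (fun g => (fun t => Cconj (fst g t), fun t => (- Cconj (snd g t))%C)) _ _ hg)). }
have e3 Y g : In g Gamma -> ex_RInt (V := E) (fun t =>
    cscal (- (1))%C (cscal (- Cconj (snd g t))%C (Rs (Cconj (fst g t)) Y))) 0 1.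
{ move=> hg.
  exact (ex_RInt_linear E E (cscal (- (1))%C) _ _ _ (is_linear_cscal E _) (e2 Y g hg)). }
have twice Y : sum_RInt (V := E) (h Y) Gamma = plus (p Y) (p Y).
{ have -> : plus (p Y) (p Y) =
    plus (p Y) (cscal (- (1))%C (riesz_projector E Rs (conj_cycle Gamma) Y)).
  { have := projector_conj Y; move: (riesz_projector E Rs (conj_cycle Gamma) Y) (p Y) => a b ab.
    have -> : cscal (- (1))%C a = minus b (plus b a) :> E by cmodule.
    change (plus b b = plus b (minus b (plus b a)) :> E).
    have -> : plus b a = zero :> E by exact: ab.
    cmodule. }
  rewrite /h (sum_RInt_plus _ E) //; [|exact: e1|exact: e3].
  congr plus.
  rewrite (sum_RInt_linear _ E E (cscal (- (1))%C)); [|exact: is_linear_cscal|exact: e2].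
  by rewrite /riesz_projector /cycle_integral /conj_cycle /sum_RInt [in RHS]map_map. }
have pt : sum_RInt (V := E) (h X) Gamma = mult (sum_RInt (V := E) (h one) Gamma) X.
{ rewrite -(sum_RInt_linear _ E E (fun Y : BOp V => mult Y X)).
  - apply: sum_RInt_ext => g hg t ht; rewrite /h !Rs_pair.
    by rewrite -mult_assoc mult_minus_l -!Bscal_mult mult_one_l -mult_assoc mult_one_l.
  - exact: is_linear_Bmult_r.
  - move=> g hg; apply: (ex_RInt_plus (V := E)); [exact: e1|exact: e3]. }
rewrite !twice in pt.
have half Y : Y = scal (/ 2) (plus Y Y) :> E.
{ rewrite -(cscal_real E); set a := RtoC _.
  transitivity (cscal (a + a)%C Y); last by cmodule.
  have -> : (a + a)%C = 1 by apply: injective_projections; rewrite /a /=; field.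
  by rewrite cscal_1. }
rewrite (half (p X)) pt Bscal_mult; congr mult; symmetry; exact: half.
Qed.

Lemma riesz_P_projector : riesz_P T G = p one.
Proof.
apply: (contour_integral_cycle I hI E G
  (fun s d => Brmul (SL_inv s T) d) (fun s => Rs s one)); first exact: Rs_continuous.
move=> s d hs hd; rewrite SL_inv_qresolvent.
change (scal (/ (2 * PI)) (Brmul (qresolvent V T s one) d) =
  Brmul (qresolvent V T (embed I (coord I s)) one)
    (embed I (coord I (scal (/ (2 * PI)) d)))).
rewrite !embed_coord //; last exact: slice_scal.
symmetry; exact: (linear_scal _ (is_linear_Brmul V _)).
Qed.

Lemma riesz_P_commute : mult T (riesz_P T G) = mult (riesz_P T G) T.
Proof.
rewrite riesz_P_projector -projector_mult.
have := riesz_projector_commute E M rho Rs clinear_M slice_resolvent_set_open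
  (fun z _ => clinear_Rs z) Rs_right Rs_left Gamma (regular_slice_cycle I hI G) Gamma_rho one.
by rewrite /M mult_one_r => ->.
Qed.

Lemma riesz_P_idempotent : mult (riesz_P T G) (riesz_P T G) = riesz_P T G.
Proof. by rewrite riesz_P_projector -projector_mult projector_idempotent. Qed.

Lemma cycle_integral_const : cycle_integral Gamma (fun _ => one : E) = zero.
Proof.
rewrite /cycle_integral /sum_RInt map_map.
have hl : is_linear (U := quat_NormedModule) (V := BOp_NormedModule V)
  (fun v => Brmul (one : BOp V) (embed I (coord I (dsI I v)))).
{ apply: (is_linear_comp (U := quat_NormedModule) (V := quat_NormedModule)
    (W := BOp_NormedModule V) (fun v => embed I (coord I (dsI I v))) (fun s => Brmul one s));
    last exact: is_linear_Brmul.
  apply: (is_linear_comp (U := quat_NormedModule) (V := quat_NormedModule)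
    (W := quat_NormedModule) (dsI I) (fun s => embed I (coord I s))).
  - exact: is_linear_dsI.
  - exact: is_linear_embed_coord. }
have := sum_RInt_linear _ quat_CompleteNormedModule (BOp_CompleteNormedModule V) _
  (fun (g : jordan_curve I) t => velocity g t) G hl.
rewrite sum_velocity (linear_zero _ hl); apply=> g hg.
apply: (ex_RInt_continuous (V := quat_CompleteNormedModule)) => t.
rewrite Rmin_left ?Rmax_right; try lra.
exact: velocity_continuous.
Qed.

Lemma riesz_T_projector : riesz_T T G = mult T (riesz_P T G).
Proof.
have hc := Rs_continuous one.
have hid : continuous_on_cycle (E := E) Gamma (fun s => cscal s (Rs s one)).
{ apply: continuous_on_cycle_cscal => // s hs; exact: continuous_id. }
transitivity (cycle_integral (E := E) Gamma (fun s => cscal s (Rs s one))).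
{ apply: (contour_integral_cycle I hI E G
    (fun s d => Brmul (Brmul (SL_inv s T) d) s)) => // s d hs hd.
  rewrite SL_inv_qresolvent.
  change (scal (/ (2 * PI)) (Brmul (Brmul (qresolvent V T s one) d) s) =
    Brmul (Brmul (qresolvent V T (embed I (coord I s)) one) (embed I (coord I s)))
      (embed I (coord I (scal (/ (2 * PI)) d)))).
  rewrite !Brmul_Brmul -embed_mult // Cmult_comm embed_mult // !embed_coord //;
    last exact: slice_scal.
  rewrite -!Brmul_Brmul.
  have -> : Brmul (qresolvent V T s one) (scal (/ (2 * PI)) d) =
    scal (/ (2 * PI)) (Brmul (qresolvent V T s one) d).
  { exact: (linear_scal _ (is_linear_Brmul V _)). }
  exact: BOp_eq. }
rewrite (cycle_integral_ext E _ _ (fun s => plus one (M (Rs s one)))); last first.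
{ move=> s /Gamma_rho hs; rewrite -{2}(Rs_right s one hs); cmodule. }
rewrite cycle_integral_plus.
- rewrite cycle_integral_const plus_zero_l riesz_P_projector.
  exact: (cycle_integral_clinear E _ _ _ clinear_M (regular_slice_cycle I hI G) hc).
- exact: regular_slice_cycle.
- by move=> s hs; exact: continuous_const.
- exact: (continuous_on_cycle_clinear E M _ _ clinear_M hc).
Qed.

Lemma riesz_SL_equation s : invertible (Q_op T s) ->
  minus (Brmul (mult (riesz_P T G) (SL_inv s T)) s) (mult (riesz_T T G) (SL_inv s T)) =
  riesz_P T G.
Proof.
move=> hs; rewrite riesz_T_projector riesz_P_commute Brmul_mult -mult_assoc -mult_minus_r.
by rewrite (SL_inv_equation V I hI) // mult_one_r.
Qed.

Lemma riesz_SR_equation s : invertible (Q_op T s) ->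
  minus (Blmul s (mult (SR_inv s T) (riesz_P T G))) (mult (SR_inv s T) (riesz_T T G)) =
  riesz_P T G.
Proof.
move=> hs; rewrite riesz_T_projector -Blmul_mult mult_assoc -mult_minus_l.
by rewrite (SR_inv_equation V I hI) // mult_one_l.
Qed.

End Riesz.

Theorem theorem4p2 (V : TwoSidedBanach) (T : BOp V)
  (sigma1 sigma2 U1 U2 : quat -> Prop)
  (hsigma : forall s, S_spectrum T s <-> sigma1 s \/ sigma2 s)
  (hdist : Rbar_lt 0 (set_dist sigma1 sigma2))
  (hopen1 : open U1) (hopen2 : open U2)
  (haxial1 : axially_symmetric U1) (haxial2 : axially_symmetric U2)
  (hjordan1 : forall I, imag_unit I -> jordan_boundary I U1)
  (hjordan2 : forall I, imag_unit I -> jordan_boundary I U2)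
  (hsub1 : forall s, sigma1 s -> U1 s) (hsub2 : forall s, sigma2 s -> U2 s)
  (hdisj : forall s, ~ (closure U1 s /\ closure U2 s))
  (I : quat) (hI : imag_unit I) (G1 G2 : list (jordan_curve I))
  (hG1 : positive_boundary U1 G1) (hG2 : positive_boundary U2 G2) :
  (forall G, G = G1 \/ G = G2 ->
     let P := riesz_P T G in
     mult P P = P /\ mult T P = mult P T) /\
  (forall lambda, S_resolvent_set T lambda ->
   forall G, G = G1 \/ G = G2 ->
     let P := riesz_P T G in
     let TP := riesz_T T G in
     minus (Brmul (mult P (SL_inv lambda T)) lambda)
           (mult TP (SL_inv lambda T)) = P /\
     minus (Blmul lambda (mult (SR_inv lambda T) P))
           (mult (SR_inv lambda T) TP) = P).
Proof.
have hsp1 s : S_spectrum T s -> U1 s \/ U2 s.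
{ by move=> /hsigma [/hsub1|/hsub2]; [left|right]. }
have hsp2 s : S_spectrum T s -> U2 s \/ U1 s.
{ by move=> /hsp1; tauto. }
have hdisj2 s : ~ (closure U2 s /\ closure U1 s) by move=> h; apply: (hdisj s); tauto.
split.
- move=> G [] -> P; split; rewrite /P.
  + exact: (riesz_P_idempotent V T I hI U1 U2).
  + exact: (riesz_P_commute V T I hI U1 U2).
  + exact: (riesz_P_idempotent V T I hI U2 U1).
  + exact: (riesz_P_commute V T I hI U2 U1).
- move=> lambda /NNPP hl G [] -> P TP; split; rewrite /P /TP.
  + exact: (riesz_SL_equation V T I hI U1 U2).
  + exact: (riesz_SR_equation V T I hI U1 U2).
  + exact: (riesz_SL_equation V T I hI U2 U1).
  + exact: (riesz_SR_equation V T I hI U2 U1).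
Qed.
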